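(* Let $\mathcal H_1,\mathcal H_2$ be Hilbert spaces, $A$ a self-adjoint operator in $\mathcal H_1$ bounded from below, $B$ a densely defined closable operator from $\mathcal H_2$ to $\mathcal H_1$, and $D$ a self-adjoint operator in $\mathcal H_2$ bounded from above; let $\mathfrak a$, $\mathfrak d$ be the closed quadratic forms associated with $A$, $D$. Let $$\mathcal M_0=\begin{pmatrix}A&B\\-B^*&D\end{pmatrix},\qquad \mathrm{dom}(\mathcal M_0)=\bigl(\mathrm{dom}(A)\cap\mathrm{dom}(B^* )\bigr)\times\bigl(\mathrm{dom}(B)\cap\mathrm{dom}(D)\bigr),\qquad J=\begin{pmatrix}I&0\\0&-I\end{pmatrix}$$ in $\mathcal H_1\oplus\mathcal H_2$. Consider the conditions (I) $\mathrm{dom}(\mathfrak a)\subset\mathrm{dom}(B^* )$, $\mathrm{dom}(B)\subset\mathrm{dom}(D)$, and $\mathrm{dom}(B)$ is a core for $D$; (II) $\mathrm{dom}(\mathfrak a)\subset\mathrm{dom}(B^* )$ and $\mathrm{dom}(\mathfrak d)\subset\mathrm{dom}(B)$. If (I) holds, then $J\mathcal M_0$ is essentially self-adjoint and $\mathcal M_0$ is closable; denote its closure by $\mathcal M$. If (II) holds, then $J\mathcal M_0$ is self-adjoint and $\mathcal M_0$ is closed with domain $\mathrm{dom}(A)\times\mathrm{dom}(D)$, and hence equal to its closure $\mathcal M$. Let $\nu<\min\sigma(A)$ be arbitrary. In both cases (I) and (II), $$\mathrm{dom}(\mathcal M)=\Bigl\{\tbinom{x}{y}:\ y\in\mathrm{dom}(D),\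 x+\overline{(A-\nu)^{-1}B}\,y\in\mathrm{dom}(A)\Bigr\},$$ $$\mathcal M\binom{x}{y}=\begin{pmatrix}(A-\nu)\bigl(x+\overline{(A-\nu)^{-1}B}\,y\bigr)+\nu x\\ -B^*x+Dy\end{pmatrix},\qquad \binom{x}{y}\in\mathrm{dom}(\mathcal M).$$ If $(x,y)^T\in\mathrm{dom}(\mathcal M)$, then $x\in\mathrm{dom}(\mathfrak a)$. Moreover, for $(x,y)^T\in\mathrm{dom}(\mathcal M)$ and $(\hat x,\hat y)^T\in\mathrm{dom}(\mathfrak a)\times\mathcal H_2$, $$\Bigl\langle\mathcal M\binom{x}{y},\binom{\hat x}{\hat y}\Bigr\rangle=\mathfrak a[x,\hat x]+\langle y,B^*\hat x\rangle-\langle B^*x,\hat y\rangle+\langle Dy,\hat y\rangle.$$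
   Context: Hilbert spaces are non-zero and complex; $\langle\cdot,\cdot\rangle$ (linear in the first argument) denotes the inner product in $\mathcal H_1$, $\mathcal H_2$ and $\mathcal H_1\oplus\mathcal H_2$. The form $\mathfrak a$ has domain $\mathrm{dom}(|A|^{1/2})$, with sesquilinear form $\mathfrak a[x,y]$ and $\mathfrak a[x]=\mathfrak a[x,x]$; similarly $\mathfrak d$ has domain $\mathrm{dom}(|D|^{1/2})$. If $\mathrm{dom}(\mathfrak a)\subset\mathrm{dom}(B^* )$ and $\nu<\min\sigma(A)$, then $(A-\nu)^{-1}B$ is bounded and densely defined; $\overline{(A-\nu)^{-1}B}$ denotes its closure, a bounded operator defined on all of $\mathcal H_2$. *)

(* Defs.v *)
(* A complex Hilbert space is a [completeNormedModType R[i]]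
   together with a form [ip : {dot H for Num.conj}] (positive definite,
   Hermitian, linear in the first argument) inducing its norm. *)
From HB Require Import structures.
From mathcomp Require Import all_boot all_order all_algebra.
From mathcomp Require Import sesquilinear complex.
From mathcomp Require Import all_classical all_reals all_analysis.

Set Implicit Arguments.
Unset Strict Implicit.
Unset Printing Implicit Defensive.

Import Order.TTheory GRing.Theory Num.Theory.
Import numFieldNormedType.Exports.

Local Open Scope classical_set_scope.
Local Open Scope ring_scope.
Local Open Scope complex_scope.

Definition inner_product_norm (R : realType) (H : normedModType R[i])
    (ip : {dot H for Num.conj}) : Prop :=
  forall x : H, ip x x = `|x| ^+ 2.

Section DirectSum.
Variables (R : realType) (H1 H2 : normedModType R[i]).
Variables (ip1 : {dot H1 for Num.conj}) (ip2 : {dot H2 for Num.conj}).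

Definition dsum_ip (p q : H1 * H2) : R[i] := ip1 p.1 q.1 + ip2 p.2 q.2.

Let dsum_ip_bilinear : bilinear_for
  (GRing.Scale.Law.clone _ _ *%R _)
  (GRing.Scale.Law.clone _ _ (Num.conj \; *%R) _) dsum_ip.
Proof.
split=> [q|p] c x y; rewrite /dsum_ip /=.
  by rewrite !linearPl /= mulrDr addrACA.
by rewrite !linearPr /= mulrDr addrACA.
Qed.

HB.instance Definition _ := bilinear_isBilinear.Build R[i]
  (H1 * H2)%type (H1 * H2)%type R[i] _ _ dsum_ip dsum_ip_bilinear.

Let dsum_ip_hermitian p q :
  dsum_ip p q = (-1) ^+ false * Num.conj (dsum_ip q p).
Proof.
rewrite /dsum_ip (hermC ip1 p.1) (hermC ip2 p.2) !expr0 !mul1r.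
by rewrite [RHS]rmorphD.
Qed.

HB.instance Definition _ := isHermitianSesquilinear.Build R[i]
  (H1 * H2)%type false Num.conj dsum_ip dsum_ip_hermitian.

Let dsum_ip_gt0 p : p != 0 -> 0 < dsum_ip p p.
Proof.
case: p => x y; rewrite -pair_eqE negb_and /dsum_ip /= => /orP[h|h].
  by rewrite ltr_wpDr ?dnorm_ge0 ?dnorm_gt0.
by rewrite ltr_wpDl ?dnorm_ge0 ?dnorm_gt0.
Qed.

HB.instance Definition _ := isDotProduct.Build R[i]
  (H1 * H2)%type dsum_ip dsum_ip_gt0.

(* The library norms [H1 * H2] by the maximum of the two norms; this is
   equivalent to the Hilbert norm of the direct sum, so both have the same
   topology, in particular the same closures of graphs. *)
Lemma dsum_ip_norm_equiv :
    inner_product_norm ip1 -> inner_product_norm ip2 ->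
  forall p : H1 * H2, `|p| ^+ 2 <= dsum_ip p p <= 2 * `|p| ^+ 2.
Proof.
move=> n1 n2 [x y]; rewrite /dsum_ip n1 n2 prod_normE /=.
set m := Num.max _ _.
have hx : `|x| <= m by rewrite comparable_le_max ?lexx ?real_comparable.
have hy : `|y| <= m by rewrite comparable_le_max ?lexx ?orbT ?real_comparable.
apply/andP; split; last first.
  by rewrite mulrDl mul1r lerD // lerXn2r ?nnegrE // (le_trans _ hx).
rewrite /m maxEle; case: ifP => _; last by rewrite lerDl exprn_ge0.
by rewrite lerDr exprn_ge0.
Qed.

End DirectSum.

(* The value of [T] is meaningful on [dom T] only; two operators are equal when
   their graphs are.  Linearity is a separate predicate. *)
Record partop (T U : Type) := Partop { dom : set T; apply_op :> T -> U }.

Section Operators.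
Variable R : realType.
Implicit Types U V W : normedModType R[i].

Definition linear_op U V (T : partop U V) : Prop :=
  dom T 0 /\ forall (c : R[i]) x y, dom T x -> dom T y ->
    dom T (c *: x + y) /\ T (c *: x + y) = c *: T x + T y.

Definition graph U V (T : partop U V) : set (U * V) :=
  [set p | dom T p.1 /\ p.2 = T p.1].

Definition op_eq U V (S T : partop U V) : Prop := graph S = graph T.

Definition closed_op U V (T : partop U V) : Prop := closed (graph T).

Definition closable_op U V (T : partop U V) : Prop :=
  forall x y z, closure (graph T) (x, y) -> closure (graph T) (x, z) -> y = z.

(* The operator with graph [closure (graph T)], for closable [T]. *)
Definition closure_op U V (T : partop U V) : partop U V :=
  Partop [set x | exists y, closure (graph T) (x, y)]
         (fun x => get [set y | closure (graph T) (x, y)]).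

Definition bounded_op U V (T : partop U V) : Prop :=
  exists c : R, forall x, dom T x -> `|T x| <= c%:C * `|x|.

Definition restrict_op U V (T : partop U V) (X : set U) : partop U V :=
  Partop (dom T `&` X) T.

Definition core U V (T : partop U V) (X : set U) : Prop :=
  X `<=` dom T /\ op_eq (closure_op (restrict_op T X)) T.

Definition opp_op U V (T : partop U V) : partop U V :=
  Partop (dom T) (fun x => - T x).

Definition shift_op U (T : partop U U) (z : R[i]) : partop U U :=
  Partop (dom T) (fun x => T x - z *: x).

Definition comp_op U V W (S : partop V W) (T : partop U V) : partop U W :=
  Partop [set x | dom T x /\ dom S (T x)] (fun x => S (T x)).

(* The inverse, for [T] injective on its domain. *)
Definition inv_op U V (T : partop U V) : partop V U :=
  Partop [set y | exists2 x, dom T x & T x = y]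
         (fun y => get [set x | dom T x /\ T x = y]).

Definition resolvent_set U (T : partop U U) : set R[i] :=
  [set z | [/\ {in dom T &, injective (shift_op T z)},
               dom (inv_op (shift_op T z)) = setT &
               bounded_op (inv_op (shift_op T z))]].

Definition spectrum U (T : partop U U) : set R[i] := ~` resolvent_set T.

Definition block_op U V (T11 : partop U U) (T12 : partop V U)
    (T21 : partop U V) (T22 : partop V V) : partop (U * V)%type (U * V)%type :=
  Partop ((dom T11 `&` dom T21) `*` (dom T12 `&` dom T22))
         (fun p => (T11 p.1 + T12 p.2, T21 p.1 + T22 p.2)).

Definition J_op U V : partop (U * V)%type (U * V)%type :=
  Partop setT (fun p => (p.1, - p.2)).

(* The adjoint, for densely defined [T]. *)
Definition adjoint U V (ipU : {dot U for Num.conj}) (ipV : {dot V for Num.conj})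
    (T : partop U V) : partop V U :=
  Partop [set y | exists z, forall x, dom T x -> ipV (T x) y = ipU x z]
         (fun y => get [set z | forall x, dom T x -> ipV (T x) y = ipU x z]).

Definition selfadjoint U (ip : {dot U for Num.conj}) (T : partop U U) : Prop :=
  dense (dom T) /\ op_eq T (adjoint ip ip T).

Definition ess_selfadjoint U (ip : {dot U for Num.conj}) (T : partop U U)
    : Prop :=
  closable_op T /\ selfadjoint ip (closure_op T).

(* [c <= z] in [R[i]] means that [z - c] is a nonnegative real. *)
Definition bounded_from_below U (ip : {dot U for Num.conj}) (T : partop U U)
    : Prop :=
  exists c : R, forall x, dom T x -> c%:C * ip x x <= ip (T x) x.

Definition bounded_from_above U (ip : {dot U for Num.conj}) (T : partop U U)
    : Prop :=
  exists c : R, forall x, dom T x -> ip (T x) x <= c%:C * ip x x.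

Definition nonneg_selfadjoint U (ip : {dot U for Num.conj}) (T : partop U U)
    : Prop :=
  selfadjoint ip T /\ forall x, dom T x -> 0 <= ip (T x) x.

(* [S = T^(1/2)], for [T] nonnegative self-adjoint. *)
Definition is_sqrt U (ip : {dot U for Num.conj}) (T S : partop U U) : Prop :=
  nonneg_selfadjoint ip S /\ op_eq (comp_op S S) T.

(* [P = |T|], that is, [(T^* T)^(1/2)]. *)
Definition is_abs U (ip : {dot U for Num.conj}) (T P : partop U U) : Prop :=
  is_sqrt ip (comp_op (adjoint ip ip T) T) P.

(* The sesquilinear form [t x y] is linear in [x]; the quadratic form is its
   diagonal.  Values outside of [fdom t] are meaningless. *)
Record qform U := Qform { fdom : set U; fval :> U -> U -> R[i] }.

Definition hermitian_form U (t : qform U) : Prop :=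
  [/\ fdom t 0,
      forall (c : R[i]) x y, fdom t x -> fdom t y -> fdom t (c *: x + y),
      forall (c : R[i]) x y z, fdom t x -> fdom t y -> fdom t z ->
        t (c *: x + y) z = c * t x z + t y z &
      forall x y, fdom t x -> fdom t y -> t x y = Num.conj (t y x)].

Definition semibounded_form U (ip : {dot U for Num.conj}) (t : qform U) : Prop :=
  exists c : R, (forall x, fdom t x -> c%:C * ip x x <= t x x) \/
                (forall x, fdom t x -> t x x <= c%:C * ip x x).

(* Kato's definition, valid for forms semibounded from either side. *)
Definition closed_form U (t : qform U) : Prop :=
  forall (u : nat -> U) (x : U), (forall n, fdom t (u n)) ->
    u @ \oo --> x ->
    (forall e : R, 0 < e -> exists N : nat, forall m n : nat,
       (N <= m)%N -> (N <= n)%N -> `|t (u m - u n) (u m - u n)| < e%:C) ->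
    fdom t x /\ (fun n => t (u n - x) (u n - x) : R[i]^o) @ \oo --> (0 : R[i]^o).

(* [t] is the closed quadratic form associated with the semibounded self-adjoint
   operator [T]: [T] is the operator that [t] defines by the first
   representation theorem, and [t] has domain [dom (|T|^(1/2))]. *)
Definition associated_form U (ip : {dot U for Num.conj}) (T : partop U U)
    (t : qform U) : Prop :=
  [/\ hermitian_form t, semibounded_form ip t, dense (fdom t), closed_form t &
      graph T = [set p | fdom t p.1 /\
                         forall y, fdom t y -> t p.1 y = ip p.2 y]] /\
  (exists P S, [/\ is_abs ip T P, is_sqrt ip P S & fdom t = dom S]).

End Operators.

Definition below_min (R : realType) (z : R[i]) (X : set R[i]) : Prop :=
  exists m : R[i], [/\ X m, lbound X m & z < m].

(* Main.v *)
(* Let [nu] be below the form [a] and let [B'] be the adjoint of [B].  By uniform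
   boundedness [B'] is bounded on the Hilbert space [(dom a, a - nu)], so by the
   Riesz theorem there is a bounded [K] with [(a - nu)[K y, x] = <y, B' x>]; it
   extends [(A - nu)^-1 B].  Writing [u = x + K y], the operator
   [S (x, y) = (A u - nu K y, - B' x + D y)] on the set [y \in dom D],
   [u \in dom A] extends [M0].  Testing the adjoint relation for [J S] with
   vectors [(x, 0)] and [(- K y, y)] decouples it into those of [A] and [D], so
   [J S] is self-adjoint; in particular [S] is closed.  In case (I) a core
   sequence [y_n] for [D] and [x_n = u - K y_n] show that [M0] is dense in [S],
   in case (II) the domains coincide.  Another point of the resolvent set of [A]
   changes [K] by the resolvent identity, which does not change [S]. *)
Require Import Defs.
From HB Require Import structures.
From mathcomp Require Import all_boot all_order all_algebra.
From mathcomp Require Import sesquilinear complex.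
From mathcomp Require Import all_classical all_reals all_analysis.
From mathcomp Require Import ring lra.

Set Implicit Arguments.
Unset Strict Implicit.
Unset Printing Implicit Defensive.

Import Order.TTheory GRing.Theory Num.Theory.
Import numFieldNormedType.Exports.

Local Open Scope classical_set_scope.
Local Open Scope ring_scope.
Local Open Scope complex_scope.

Import Normc.

(** * Hermitian forms *)

(** The [nu] of the statement is known only through the spectrum: it yields a bounded resolvent, but
    no sign for the form [a - nu]. Hence [K] is built at a point read off from the form itself: if
    [c] is a lower bound of [a], the shift by [c - 1] leaves a form that dominates the inner
    product, so that its norm is definite and complete. The given [nu] enters at the end, through
    its resolvent. Finding [c] takes an argument, since [semibounded_form] does not say on which
    side [a] is bounded.

    What makes the adjoint relation decouple is that [B' K] is bounded and symmetric. With
    [u = x + K y] one has [B' x = B' u - B' K y], and pairing [B' u] with a vector [y'] is, up to a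
    [nu] term, pairing [A u] with [K y']. The pairing with [J S] thus becomes a Hermitian expression
    in [u] and [y].

    The norm of [H1 * H2] is the maximum norm, which [dsum_ip] does not induce; the facts on
    adjoints are therefore derived from continuity of the inner product alone. *)

(* Norms over the scalars [R[i]] take values in [R[i]]. *)
Definition rnorm (R : realType) (V : normedZmodType R[i]) (x : V) : R :=
  complex.Re `|x|.

Section RealNorm.
Variables (R : realType) (V : normedModType R[i]).
Implicit Types (x y : V) (z w : R[i]).

Lemma rnormE (W : normedZmodType R[i]) (x : W) : `|x| = (rnorm x)%:C.
Proof. by rewrite /rnorm RRe_real // normr_real. Qed.

Lemma rnorm_ge0 (W : normedZmodType R[i]) (x : W) : 0 <= rnorm x.
Proof. by rewrite -lecR -rnormE normr_ge0. Qed.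

Lemma rnorm_eq0 (W : normedZmodType R[i]) (x : W) : rnorm x = 0 -> x = 0.
Proof. by move=> x0; apply/eqP; rewrite -normr_eq0 rnormE x0. Qed.

Lemma rnormN (W : normedZmodType R[i]) (x : W) : rnorm (- x) = rnorm x.
Proof. by rewrite /rnorm normrN. Qed.

Lemma rnormB (W : normedZmodType R[i]) (x y : W) :
  rnorm (x - y) = rnorm (y - x).
Proof. by rewrite -rnormN opprB. Qed.

Lemma rnormD (W : normedZmodType R[i]) (x y : W) :
  rnorm (x + y) <= rnorm x + rnorm y.
Proof. by rewrite -lecR rmorphD /= -!rnormE ler_normD. Qed.

Lemma rnormZ z x : rnorm (z *: x) = normc z * rnorm x.
Proof. by apply: complexI; rewrite rmorphM /= -!rnormE normrZ. Qed.

Lemma normcD z w : normc (z + w) <= normc z + normc w.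
Proof. exact: le_normcD. Qed.

Lemma normc_ge0 z : 0 <= normc z.
Proof. by case: z => p q; exact: sqrtr_ge0. Qed.

Lemma normcC (r : R) : normc r%:C = `|r|.
Proof. by rewrite /= expr0n /= addr0 sqrtr_sqr. Qed.

Lemma conj_real (r : R) : Num.conj r%:C = r%:C.
Proof. exact: conjc_real. Qed.

Lemma conjD z w : Num.conj (z + w) = Num.conj z + Num.conj w.
Proof. exact: rmorphD. Qed.

Lemma conjB z w : Num.conj (z - w) = Num.conj z - Num.conj w.
Proof. exact: rmorphB. Qed.

Lemma conjM z w : Num.conj (z * w) = Num.conj z * Num.conj w.
Proof. exact: rmorphM. Qed.

Lemma normc_conj z : normc (Num.conj z) = normc z.
Proof. by case: z => p q /=; rewrite sqrrN. Qed.

Lemma Re_le_normc z : complex.Re z <= normc z.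
Proof. by rewrite (le_trans (ler_norm _)) // -lecR (normc_ge_Re z). Qed.

Lemma mulC_conj z : z * Num.conj z = (normc z ^+ 2)%:C.
Proof. by rewrite [RHS]rmorphXn; exact/esym/sqr_normc. Qed.

End RealNorm.

Definition sqform (R : realType) (U : normedModType R[i]) (t : qform U)
    (x : U) : R := Num.sqrt (complex.Re (t x x)).

Section HermitianForm.
Variables (R : realType) (U : normedModType R[i]) (t : qform U).
Hypothesis ht : hermitian_form t.
Local Notation X := (fdom t).
Implicit Types (x y z : U) (c : R[i]).

Lemma fdom0 : X 0. Proof. by case: ht. Qed.
Lemma fdomL c x y : X x -> X y -> X (c *: x + y).
Proof. by case: ht => _ h _ _; exact: h. Qed.
Lemma fdomD x y : X x -> X y -> X (x + y).
Proof. by move=> Xx Xy; rewrite -(scale1r x); exact: fdomL. Qed.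
Lemma fdomZ c x : X x -> X (c *: x).
Proof. by move=> Xx; rewrite -[_ *: _]addr0; exact: fdomL fdom0. Qed.
Lemma fdomN x : X x -> X (- x).
Proof. by move=> Xx; rewrite -scaleN1r; exact: fdomZ. Qed.
Lemma fdomB x y : X x -> X y -> X (x - y).
Proof. by move=> Xx Xy; apply/fdomD => //; exact: fdomN. Qed.

Lemma qformC x y : X x -> X y -> t x y = Num.conj (t y x).
Proof. by case: ht => _ _ _; exact. Qed.
Lemma qformL c x y z : X x -> X y -> X z ->
  t (c *: x + y) z = c * t x z + t y z.
Proof. by case: ht => _ _ h _; exact: h. Qed.
Lemma qformDl x y z : X x -> X y -> X z -> t (x + y) z = t x z + t y z.
Proof. by move=> *; rewrite -{1}(scale1r x) qformL // mul1r. Qed.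
Lemma qform0l z : X z -> t 0 z = 0.
Proof.
move=> Xz; have := qformDl fdom0 fdom0 Xz.
by rewrite addr0 => /eqP; rewrite -[X in X == _]addr0 (inj_eq (addrI _))
  eq_sym => /eqP.
Qed.
Lemma qformZl c x z : X x -> X z -> t (c *: x) z = c * t x z.
Proof.
by move=> *; rewrite -[_ *: _]addr0 qformL ?qform0l ?addr0 //; exact: fdom0.
Qed.
Lemma qformNl x z : X x -> X z -> t (- x) z = - t x z.
Proof. by move=> *; rewrite -scaleN1r qformZl // mulN1r. Qed.
Lemma qformBl x y z : X x -> X y -> X z -> t (x - y) z = t x z - t y z.
Proof. by move=> *; rewrite qformDl ?qformNl //; exact: fdomN. Qed.
Lemma qformDr x y z : X x -> X y -> X z -> t x (y + z) = t x y + t x z.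
Proof.
move=> Xx Xy Xz; rewrite qformC ?qformDl //; last exact: fdomD.
by rewrite rmorphD /= -!qformC.
Qed.
Lemma qformZr c x y : X x -> X y -> t x (c *: y) = Num.conj c * t x y.
Proof.
move=> Xx Xy; rewrite qformC ?qformZl //; last exact: fdomZ.
by rewrite rmorphM /= -!qformC.
Qed.
Lemma qformNr x z : X x -> X z -> t x (- z) = - t x z.
Proof. by move=> *; rewrite -scaleN1r qformZr // rmorphN rmorph1 mulN1r. Qed.
Lemma qformBr x y z : X x -> X y -> X z -> t x (y - z) = t x y - t x z.
Proof. by move=> *; rewrite qformDr ?qformNr //; exact: fdomN. Qed.

Hypothesis pos : forall x, X x -> 0 <= t x x.

Lemma sqform_ge0 x : 0 <= sqform t x. Proof. exact: sqrtr_ge0. Qed.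

Lemma sqformE x : X x -> t x x = (sqform t x ^+ 2)%:C.
Proof.
move=> /pos tx; rewrite sqr_sqrtr; last by move: tx; rewrite lecE => /andP[].
by rewrite RRe_real ?ger0_real.
Qed.

Lemma qform_expand c x y : X x -> X y ->
  complex.Re (t (x + c *: y) (x + c *: y)) =
  sqform t x ^+ 2 + 2 * complex.Re (Num.conj c * t x y) +
  normc c ^+ 2 * sqform t y ^+ 2.
Proof.
move=> Xx Xy; have Xcy := fdomZ c Xy.
rewrite qformDl ?qformDr ?qformZr ?qformZl //; last exact: fdomD.
rewrite (sqformE Xx) (sqformE Xy) (qformC Xy Xx) [_ * (c * _)]mulrA.
rewrite [_ * c]mulrC mulC_conj.
have -> : c * (t x y)^* = Num.conj (Num.conj c * t x y).
  by rewrite rmorphM /= conjCK.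
rewrite -rmorphM !raddfD /=; case: (_ * t x y) => p q /=.
by ring.
Qed.

Lemma sqform_sqD x y : X x -> X y ->
  sqform t (x + y) ^+ 2 =
  sqform t x ^+ 2 + 2 * complex.Re (t x y) + sqform t y ^+ 2.
Proof.
move=> Xx Xy; have := qform_expand 1 Xx Xy; rewrite scale1r rmorph1 mul1r.
have -> : normc (1 : R[i]) = 1 by rewrite ?normcN normc1.
by rewrite (sqformE (fdomD Xx Xy)) /= expr1n mul1r.
Qed.

Lemma sqformZ c x : X x -> sqform t (c *: x) = normc c * sqform t x.
Proof.
move=> Xx; apply/eqP; rewrite -(@eqrXn2 _ 2) ?mulr_ge0 ?normc_ge0
  ?sqform_ge0 //.
apply/eqP; apply: complexI; rewrite -sqformE ?qformZl ?qformZr //;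
  try exact: fdomZ.
by rewrite mulrA mulC_conj sqformE // exprMn -rmorphM.
Qed.

Lemma sqformN x : X x -> sqform t (- x) = sqform t x.
Proof. by move=> Xx; rewrite -scaleN1r sqformZ // ?normcN normc1 mul1r. Qed.

Lemma sqformB x y : X x -> X y -> sqform t (x - y) = sqform t (y - x).
Proof. by move=> Xx Xy; rewrite -sqformN ?opprB //; exact: fdomB. Qed.

Lemma sqform0 : sqform t 0 = 0.
Proof. by rewrite /sqform qform0l ?sqrtr0 //; exact: fdom0. Qed.

(** Since [t] may vanish on nonzero vectors, positivity at [x - s t(x, y) y] is expanded with a free
    real [s], which is chosen only afterwards. *)
Lemma cauchy_schwarz_form x y : X x -> X y ->
  normc (t x y) <= sqform t x * sqform t y.
Proof.
move=> Xx Xy.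
set m := normc _; set p := sqform t x; set q := sqform t y.
have [p0 q0 m0] : [/\ 0 <= p, 0 <= q & 0 <= m].
  by split; rewrite ?sqform_ge0 ?normc_ge0.
have key (s : R) : 0 <= p ^+ 2 - 2 * s * m ^+ 2 + s ^+ 2 * m ^+ 2 * q ^+ 2.
  pose c := - (s%:C * t x y).
  have : 0 <= complex.Re (t (x + c *: y) (x + c *: y)).
    by have := pos (fdomD Xx (fdomZ c Xy)); rewrite lecE => /andP[].
  rewrite qform_expand //.
  have -> : Num.conj c * t x y = (- (s * m ^+ 2))%:C.
    rewrite rmorphN rmorphM /= conj_real mulNr -mulrA [_ * t x y]mulrC
      mulC_conj.
    by rewrite -rmorphM -rmorphN.
  rewrite normcN normcM normcC exprMn real_normK ?num_real //=.
  by rewrite -/m -/p -/q mulrN mulrA.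
have [m_eq0|m_neq0] := eqVneq m 0; first by rewrite m_eq0 mulr_ge0.
have m_gt0 : 0 < m ^+ 2 by rewrite exprn_gt0 // lt_def m_neq0.
have [q_eq0|q_neq0] := eqVneq q 0.
  (* For [q = 0] the expression in [key] is affine in [s]; at this [s] it equals -1. *)
  have := key ((p ^+ 2 + 1) / (2 * m ^+ 2)).
  rewrite q_eq0 expr0n /= mulr0 addr0.
  have -> : 2 * ((p ^+ 2 + 1) / (2 * m ^+ 2)) * m ^+ 2 = p ^+ 2 + 1.
    by field; rewrite ?expf_neq0.
  by lra.
rewrite -(@ler_pXn2r _ 2) ?nnegrE ?mulr_ge0 // exprMn.
have := key (q ^- 2); rewrite [X in _ - X + _](_ :
  _ = 2 * (m ^+ 2 / q ^+ 2)); last by ring.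
have -> : q ^- 2 ^+ 2 * m ^+ 2 * q ^+ 2 = m ^+ 2 / q ^+ 2 by field.
rewrite (_ : _ + _ = p ^+ 2 - m ^+ 2 / q ^+ 2); last by ring.
by rewrite subr_ge0 ler_pdivrMr ?exprn_gt0 // lt_def q_neq0.
Qed.

Lemma sqformD x y : X x -> X y -> sqform t (x + y) <= sqform t x + sqform t y.
Proof.
move=> Xx Xy; rewrite -(@ler_pXn2r _ 2) ?nnegrE ?addr_ge0 ?sqform_ge0 //.
rewrite sqform_sqD // sqrrD.
have := le_trans (Re_le_normc _) (cauchy_schwarz_form Xx Xy).
set u := complex.Re _; set v := _ * _ => uv; rewrite -[v *+ 2]mulr_natl; lra.
Qed.

Lemma parallelogram x y : X x -> X y ->
  sqform t (x + y) ^+ 2 + sqform t (x - y) ^+ 2 =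
  2 * sqform t x ^+ 2 + 2 * sqform t y ^+ 2 :> R.
Proof.
move=> Xx Xy; rewrite sqform_sqD // sqform_sqD ?sqformN ?qformNr //;
  last exact: fdomN.
by rewrite raddfN /=; ring.
Qed.

End HermitianForm.

(** * Complete forms *)

Lemma ex_inv_natS_lt (R : realType) (e : R) : 0 < e ->
  exists N : nat, forall n, (N <= n)%N -> n.+1%:R^-1 < e.
Proof.
move=> e0; exists (Num.truncn e^-1) => n Nn.
rewrite invf_plt ?posrE ?ltr0Sn // (lt_le_trans (truncnS_gt _)) //.
by rewrite ler_nat ltnS.
Qed.

Section CompleteForm.
Variables (R : realType) (U : normedModType R[i]) (t : qform U).
Local Notation X := (fdom t).
Local Notation N := (sqform t).

Definition complete_form : Prop := forall u : nat -> U,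
  (forall n, X (u n)) ->
  (forall e : R, 0 < e -> exists k : nat, forall m n : nat,
     (k <= m)%N -> (k <= n)%N -> N (u m - u n) < e) ->
  exists2 x, X x & forall e : R, 0 < e -> exists k : nat, forall n : nat,
     (k <= n)%N -> N (u n - x) < e.

Hypothesis ht : hermitian_form t.
Hypothesis pos : forall x, X x -> 0 <= t x x.
Hypothesis cpl : complete_form.

Lemma sqform_dist_triangle x y z : X x -> X y -> X z ->
  N (x - z) <= N (x - y) + N (y - z).
Proof.
move=> Xx Xy Xz; rewrite (le_trans _
  (sqformD ht pos (fdomB ht Xx Xy) (fdomB ht Xy Xz))) //.
by rewrite addrA subrK.
Qed.

(** * Uniform boundedness of seminorms on a complete form domain *)

Section UniformBoundedness.
Variables (I : Type) (p : I -> U -> R).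
Hypothesis pD : forall i x y, X x -> X y -> p i (x + y) <= p i x + p i y.
Hypothesis pZ : forall i (r : R) x, X x -> p i (r%:C *: x) = `|r| * p i x.
Hypothesis p_bounded : forall i, exists C, forall x, X x -> p i x <= C * N x.
Hypothesis p_pointwise : forall x, X x -> exists C, forall i, p i x <= C.

Let pN i x : X x -> p i (- x) = p i x.
Proof.
move=> Xx; have := pZ i (-1) Xx.
by rewrite normrN1 mul1r rmorphN rmorph1 scaleN1r.
Qed.

(** Gliding hump: [p i (2 z')] is at most [p i (x + z') + p i (x - z')], so a steep [p i] is large
    at one of two points at distance [r / 2] from [x]; by its own bound it stays large on a small
    ball there. *)
Let ball_step (n : nat) (x : U) (r : R) :
  ~ (exists C, forall i x, X x -> p i x <= C * N x) -> X x -> 0 < r ->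
  exists x' r', [/\ X x', 0 < r', r' <= r / 2, N (x' - x) <= r / 2 &
    forall w, X w -> N (w - x') <= r' -> exists i, n%:R <= p i w].
Proof.
move=> unb Xx r0.
(* This slope makes [p i] exceed [n + 1] at the multiple [z'] of [z] with [N z' = r / 2]. *)
have [i [z [Xz pz]]] : exists i z, X z /\ (n.+1%:R * 2 / r) * N z < p i z.
  apply: contrapT => h; apply: unb; exists (n.+1%:R * 2 / r) => i z Xz.
  by rewrite leNgt; apply/negP => pz; apply: h; exists i, z.
have [C pC] := p_bounded i.
have Nz0 : 0 < N z.
  rewrite lt_def sqform_ge0 andbT; apply/eqP => Nz.
  by have := pC _ Xz; rewrite Nz mulr0 leNgt => /negP; apply;
    rewrite Nz mulr0 in pz.
pose s := r / 2 / N z.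
have s0 : 0 < s by rewrite !divr_gt0.
pose z' := s%:C *: z.
have Xz' : X z' by exact: fdomZ.
have Nz' : N z' = r / 2.
  by rewrite sqformZ // normcC gtr0_norm // /s divfK // gt_eqF.
have pz' : n.+1%:R < p i z'.
  rewrite pZ // gtr0_norm // mulrC -ltr_pdivrMr //; apply: le_lt_trans pz.
  rewrite le_eqVlt; apply/orP/or_introl/eqP; rewrite /s; field.
  by rewrite !gt_eqF.
have [x' [Xx' Nx' px']] : exists x',
    [/\ X x', N (x' - x) <= r / 2 & n.+1%:R < p i x'].
  have [h|h] := ltP n.+1%:R (p i (x + z')).
    exists (x + z'); split => //; first exact: fdomD.
    by rewrite addrAC subrr add0r Nz'.
  exists (x - z'); split.
  - exact: fdomB.
  - by rewrite addrAC subrr add0r sqformN // Nz'.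
  - have := pD i (fdomD ht Xx Xz') (fdomN ht (fdomB ht Xx Xz')).
    rewrite pN; last exact: fdomB.
    have -> : x + z' + - (x - z') = 2%:C *: z'.
      by rewrite opprB addrC addrA subrK -mulr2n -scaler_nat rmorph_nat.
    by rewrite pZ // ger0_norm //; lra.
have C0 : 0 < `|C| + 1 by rewrite ltr_wpDl.
(* Within this radius [p i] drops by at most 1, which is why [n + 1] was arranged at the centre. *)
exists x', (Num.min (r / 2) (`|C| + 1)^-1).
have r'0 : 0 < Num.min (r / 2) (`|C| + 1)^-1
  by rewrite lt_min divr_gt0 // invr_gt0.
split => //; first by rewrite ge_min lexx.
move=> w Xw; rewrite le_min => /andP[_ wx']; exists i.
have := pD i Xw (fdomB ht Xx' Xw); rewrite addrC subrK => px'w.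
have : p i (x' - w) <= 1.
  apply: (le_trans (pC _ (fdomB ht Xx' Xw))).
  have Nw0 : 0 <= N (x' - w) := sqform_ge0 _ _.
  rewrite (le_trans (ler_wpM2r Nw0 (ler_norm C))) //.
  rewrite sqformB // -(mulfV (lt0r_neq0 C0)) ler_pM ?sqform_ge0 //.
  by rewrite lerDl.
by move: px'; rewrite -natr1; lra.
Qed.

(** If no common bound existed, [ball_step] would produce shrinking nested balls. Their centres are
    Cauchy for [N], and the limit lies in every ball, so the values [p i] are unbounded at it. *)
Lemma uniform_boundedness : exists C, forall i x, X x -> p i x <= C * N x.
Proof.
apply: contrapT => unb.
have /choice[f fP] (s : nat * (U * R)) : exists s' : U * R,
    X s.2.1 -> 0 < s.2.2 ->
    [/\ X s'.1, 0 < s'.2, s'.2 <= s.2.2 / 2, N (s'.1 - s.2.1) <= s.2.2 / 2 &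
      forall w, X w -> N (w - s'.1) <= s'.2 -> exists i, s.1%:R <= p i w].
  case: s => n [x r] /=.
  have [[Xx r0]|h] := pselect (X x /\ 0 < r).
    have [x' [r' h]] := ball_step n unb Xx r0.
    by exists (x', r').
  (* A dummy value: [choice] asks for a total function, and here a premise fails. *)
  by exists (0, 0) => Xx r0; case: h.
pose fix s n : U * R := if n is n'.+1 then f (n', s n') else (0, 1).
have s0 n : X (s n).1 /\ 0 < (s n).2.
  elim: n => [|n [Xn rn]] /=; first by split=> //; exact: fdom0.
  by have [] := fP (n, s n) Xn rn.
have sS n := fP (n, s n) (s0 n).1 (s0 n).2.
have s_small n : (s n).2 <= n.+1%:R^-1.
  elim: n => [|n IH]; first by rewrite invr1.
  have [_ _ /= h _ _] := sS n; apply: (le_trans h).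
  rewrite (le_trans (ler_wpM2r _ IH)) // -invfM lef_pV2 ?posrE //.
  by rewrite -natrM ler_nat muln2 -addnn addSnnS leq_addl.
(* A step and the next radius are each at most half the current radius, so centres move by no more
   than the radius loses. This keeps the limit inside each ball. *)
have s_nested m n : (n <= m)%N -> N ((s m).1 - (s n).1) <= (s n).2 - (s m).2.
  elim: m => [|m IH]; first by rewrite leqn0 => /eqP ->; rewrite !subrr sqform0.
  rewrite leq_eqVlt => /orP[/eqP ->|nm]; first by rewrite !subrr sqform0.
  have [/= Xm' _ r2 d2 _] := sS m.
  have := sqform_dist_triangle Xm' (s0 m).1 (s0 n).1.
  have := IH nm; move: r2 d2; rewrite /=; lra.
have s_dist m n : (n <= m)%N -> N ((s m).1 - (s n).1) <= (s n).2.
  by move=> /s_nested h; rewrite (le_trans h) // gerBl ltW // (s0 m).2.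
have [e e0|w Xw wlim] := cpl (fun n => (s0 n).1).
  have e2 : 0 < e / 2 by rewrite divr_gt0.
  have [k kP] := ex_inv_natS_lt e2.
  exists k => m n km kn; apply:
    (le_lt_trans (sqform_dist_triangle (s0 m).1 (s0 k).1 (s0 n).1)).
  have := s_dist _ _ km; have := s_dist _ _ kn;
    have := le_lt_trans (s_small k) (kP k (leqnn k)).
  rewrite (sqformB ht pos (s0 n).1 (s0 k).1); lra.
have [M pM] := p_pointwise Xw.
have [i pi] : exists i, (Num.truncn M).+1%:R <= p i w.
  set n := (Num.truncn M).+1.
  have [_ _ _ _ h] := sS n; apply: h => //.
  rewrite -[(f _)]/(s n.+1); apply/ler_addgt0Pr => e e0.
  have [k kP] := wlim e e0.
  pose m := maxn k n.+1.
  apply: (le_trans (sqform_dist_triangle Xw (s0 m).1 (s0 n.+1).1)).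
  rewrite addrC lerD ?s_dist ?leq_maxr // sqformB // ?ltW ?kP ?leq_maxl //.
  exact: (s0 m).1.
by move: pi; apply/negP; rewrite -ltNge (le_lt_trans (pM i)) // truncnS_gt.
Qed.
End UniformBoundedness.

(** * Riesz representation of bounded antilinear functionals *)

Variable l : U -> R[i].
Hypothesis lD : forall x y, X x -> X y -> l (x + y) = l x + l y.
Hypothesis lZ : forall c x, X x -> l (c *: x) = Num.conj c * l x.
Hypothesis l_bounded : exists C, forall x, X x -> normc (l x) <= C * N x.

Let energy x : R := N x ^+ 2 - 2 * complex.Re (l x).

Let energy_perturb c x h : X x -> X h ->
  energy (x + c *: h) =
  energy x + 2 * complex.Re (Num.conj c * (t x h - l h)) +
  normc c ^+ 2 * N h ^+ 2.
Proof.
move=> Xx Xh; rewrite /energy lD ?lZ //; last exact: fdomZ.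
have := qform_expand ht pos c Xx Xh.
rewrite (sqformE pos) /=; last exact/fdomD/fdomZ.
by move=> ->; rewrite mulrBr !raddfD raddfN /=; ring.
Qed.

(* A minimising sequence of the energy [N x ^+ 2 - 2 Re (l x)] is Cauchy by the
   parallelogram identity, and its limit represents [l]. *)
Lemma riesz_form : exists2 z, X z & forall x, X x -> t z x = l x.
Proof.
have [C lC] := l_bounded.
pose E := [set energy x | x in X].
have infE : has_inf E.
  split; first by exists (energy 0), 0 => //; exact: fdom0.
  exists (- C ^+ 2) => _ [x Xx <-]; rewrite /energy.
  have := sqr_ge0 (N x - C); have := Re_le_normc (l x); have := lC _ Xx.
  by rewrite sqrrB -mulr_natl; lra.
have energy_inf x : X x -> inf E <= energy x.
  by move=> Xx; apply: ge_inf; [exact: infE.2|exists x].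
pose delta n : R := n.+1%:R^-1.
have /choice[u uP] n : exists x, X x /\ energy x < inf E + delta n.
  have [|_ [x Xx <-] ?] := @inf_adherent _ E (delta n) _ infE.
    by rewrite invr_gt0 ltr0Sn.
  by exists x.
have Xu n : X (u n) := (uP n).1.
(* The midpoint of [u m] and [u n] has energy at least [inf E]; the parallelogram identity turns
   this into a bound on their distance. *)
have u_dist m n : N (u m - u n) ^+ 2 <= 2 * (delta m + delta n).
  have := parallelogram ht pos (Xu m) (Xu n).
  have := energy_inf _ (fdomZ ht (2^-1)%:C (fdomD ht (Xu m) (Xu n))).
  have := (uP m).2; have := (uP n).2.
  rewrite /energy (sqformZ ht pos) ?lZ ?lD ?normcC; try by do ?apply: fdomD.
  rewrite conj_real exprMn.
  have -> : complex.Re ((2^-1)%:C * (l (u m) + l (u n))) =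
     2^-1 * (complex.Re (l (u m)) + complex.Re (l (u n))).
    by case: (l (u m)) (l (u n)) => a b [c d] /=; ring.
  rewrite ger0_norm ?invr_ge0 //; lra.
have [e e0|z Xz uz] := cpl Xu.
  have e4 : 0 < e ^+ 2 / 4 by rewrite divr_gt0 ?exprn_gt0.
  have [k kP] := ex_inv_natS_lt e4.
  exists k => m n km kn.
  rewrite -(@ltr_pXn2r _ 2) ?nnegrE ?sqform_ge0 ?ltW //.
  have := u_dist m n; have : delta m < _ := kP _ km;
    have : delta n < _ := kP _ kn.
  by lra.
exists z => // h Xh.
(* The optimal step along [h] divides by [N h ^+ 2]; the added 1 keeps the divisor positive. The
   energy still falls by at least [normc w ^+ 2 / s], whereas [u n] is within [delta n] of the
   infimum. *)
pose s := N h ^+ 2 + 1.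
have s0 : 0 < s by rewrite ltr_wpDl ?sqr_ge0.
have residual n : normc (t (u n) h - l h) ^+ 2 <= s * delta n.
  set w := t _ _ - _; pose c := - (s^-1%:C * w).
  have := energy_inf _ (fdomD ht (Xu n) (fdomZ ht c Xh)).
  rewrite energy_perturb // -/w.
  have -> : Num.conj c * w = (- (s^-1 * normc w ^+ 2))%:C.
    rewrite rmorphN rmorphM /= conj_real mulNr -mulrA [_ * w]mulrC mulC_conj.
    by rewrite -rmorphM -rmorphN.
  rewrite normcN normcM normcC exprMn real_normK ?num_real //=.
  have := (uP n).2; set W := normc w ^+ 2 => h1 h2.
  have W0 : 0 <= W by exact: sqr_ge0.
  rewrite -ler_pdivrMl //.
  have : s^-1 ^+ 2 * W * N h ^+ 2 <= s^-1 * W.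
    have si0 : 0 <= s^-1 by rewrite invr_ge0 ltW.
    rewrite mulrAC ler_wpM2r // expr2 -mulrA ler_piMr //.
    by rewrite mulrC ler_pdivrMr // mul1r /s lerDl.
  lra.
apply/eqP; rewrite -subr_eq0; apply/eqP/eq0_normc/eqP.
rewrite eq_le normc_ge0 andbT; apply/ler_addgt0Pr => e e0; rewrite add0r.
have Nh1 : 0 < N h + 1 by rewrite ltr_wpDl ?sqform_ge0.
have e2 : 0 < e / 2 by rewrite divr_gt0.
have [k1 k1P] := uz _ (divr_gt0 e2 Nh1).
have [k2 k2P] := ex_inv_natS_lt (divr_gt0 (exprn_gt0 2 e2) s0).
pose n := maxn k1 k2.
have -> : t z h - l h = - t (u n - z) h + (t (u n) h - l h).
  by rewrite qformBl // opprB addrA subrK.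
apply: (le_trans (normcD _ _)); rewrite normcN [e]splitr lerD //.
  apply: (le_trans (cauchy_schwarz_form ht pos (fdomB ht (Xu n) Xz) Xh)).
  have /ltW := k1P n (leq_maxl _ _); rewrite ler_pdivlMr // => h1.
  by rewrite (le_trans _ h1) // ler_wpM2l ?sqform_ge0 // lerDl.
rewrite -(@ler_pXn2r _ 2) ?nnegrE ?normc_ge0 ?(ltW e2) //.
apply: (le_trans (residual n)); have /ltW := k2P n (leq_maxr _ _).
by rewrite ler_pdivlMr // mulrC.
Qed.

End CompleteForm.

(** * Graphs, adjoints and self-adjointness *)

Section Metric.
Variables (R : realType) (U V : normedModType R[i]).

Lemma gt0_complexP (e : R[i]) : 0 < e -> exists2 r : R, 0 < r & e = r%:C.
Proof.
move=> e0; have eE : e = (complex.Re e)%:C by rewrite RRe_real // gtr0_real.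
by exists (complex.Re e) => //; rewrite -ltcR -eE.
Qed.

Lemma rnorm_lt (W : normedModType R[i]) (x : W) (e : R) :
  (`|x| < e%:C) = (rnorm x < e).
Proof. by rewrite rnormE ltcR. Qed.

Lemma rnorm_pair (p : U * V) : rnorm p = Num.max (rnorm p.1) (rnorm p.2).
Proof.
apply: (@complexI R); rewrite -rnormE prod_normE !rnormE.
have [h|/ltW h] := leP (rnorm p.1) (rnorm p.2).
  by rewrite max_r ?lecR // max_r.
by rewrite max_l ?lecR // max_l.
Qed.

Lemma denseP (S : set U) : dense S <->
  forall (x : U) (e : R), 0 < e -> exists2 s, S s & rnorm (x - s) < e.
Proof.
split=> [dS x e e0|dS O [x Ox] oO].
  have e0' : 0 < e%:C by rewrite ltcR.
  have [|s [xs Ss]] := dS (ball x e%:C) _ (ball_open x _).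
    by exists x; exact: ballxx.
  by exists s => //; rewrite -ball_normE /= in xs; rewrite -rnorm_lt.
have /nbhs_ballP[_ /gt0_complexP[e e0 ->] xO] : nbhs x O
  by exact: open_nbhs_nbhs.
have [s Ss xs] := dS x e e0.
by exists s; split=> //; apply: xO; rewrite -ball_normE /= rnorm_lt.
Qed.

Lemma closure_graphP (T : partop U V) x y : closure (graph T) (x, y) <->
  forall e : R, 0 < e ->
    exists2 x', dom T x' & rnorm (x - x') < e /\ rnorm (y - T x') < e.
Proof.
split=> [clT e e0|clT B].
  have e0' : 0 < e%:C by rewrite ltcR.
  have [[x' y'] [[/= Tx' ->] [/=]]] := clT _ (nbhsx_ballx (x, y) _ e0').
  by rewrite -!ball_normE /= !rnorm_lt => hx hy; exists x'.
move=> /nbhs_ballP[_ /gt0_complexP[e e0 ->] BT].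
have [x' Tx' [xx' yy']] := clT e e0.
exists (x', T x'); split=> //; apply: BT; split.
  by rewrite /= -ball_normE /= rnorm_lt.
by rewrite /= -ball_normE /= rnorm_lt.
Qed.

End Metric.

Lemma le0_eps (R : realType) (x C : R) :
  0 <= C -> (forall e : R, 0 < e -> x <= C * e) -> x <= 0.
Proof.
move=> C0 h; apply/ler_addgt0Pr => e e0; rewrite add0r.
have C1 : 0 < C + 1 by rewrite ltr_wpDl.
apply: (le_trans (h _ (divr_gt0 e0 C1))).
by rewrite mulrA ler_pdivrMr // mulrC ler_wpM2l ?lerDl ?ltW.
Qed.

Section OperatorGraph.
Variables (R : realType) (U V : normedModType R[i]).
Implicit Types S T : partop U V.

Lemma op_eqP S T : op_eq S T <->
  dom S = dom T /\ forall x, dom T x -> S x = T x.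
Proof.
split=> [ST|[dST ST]].
  have h x y : (dom S x /\ y = S x) = (dom T x /\ y = T x).
    by rewrite -[LHS]/(graph S (x, y)) ST.
  split=> [|x Tx].
    apply/seteqP; split=> x hx.
      by have : dom S x /\ S x = S x by []; rewrite h => -[].
    by have : dom T x /\ T x = T x by []; rewrite -h => -[].
  by have : dom T x /\ T x = T x by []; rewrite -h => -[].
apply/seteqP; split=> -[x y] [/= hx ->]; split=> //=; first by rewrite -dST.
- by rewrite ST // -dST.
- by rewrite dST.
- by rewrite ST.
Qed.

Lemma closure_opP T x y : closure (graph T) (x, y) ->
  closure (graph T) (x, closure_op T x).
Proof.
by move=> h; apply: (@getPex _ [set z | closure (graph T) (x, z)]); exists y.
Qed.

(** Values of [closure_op] come from [get]. Once the closure is a graph the candidate is unique, so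
    one identity of graphs settles closability, domain and values. *)
Lemma closure_op_eq S T : closure (graph S) = graph T ->
  [/\ closable_op S, dom (closure_op S) = dom T &
      forall x, dom T x -> closure_op S x = T x].
Proof.
move=> ST; split=> [x y z|  |x Tx].
- by rewrite ST => -[/= _ ->] [/= _ ->].
- apply/seteqP; split=> x /=; first by case=> y; rewrite ST => -[].
  by move=> Tx; exists (T x); rewrite ST.
- have : closure (graph S) (x, T x) by rewrite ST.
  by move=> /closure_opP; rewrite ST => -[].
Qed.

End OperatorGraph.

(** Viewing the inner product as a form lets Cauchy-Schwarz and completeness be formulated once, for
    [H] and for form domains. *)
Definition ip_form (R : realType) (H : normedModType R[i])
  (ip : {dot H for Num.conj}) : qform H := Qform setT (fun x y => ip x y).

Section InnerProduct.
Variables (R : realType) (H : normedModType R[i]) (ip : {dot H for Num.conj}).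

Lemma ip_formH : hermitian_form (ip_form ip).
Proof.
split=> //= [c x y z _ _ _|x y _ _]; first by rewrite linearPl.
by rewrite (hermC ip x y) expr0 mul1r.
Qed.

Lemma ip_form_pos x : fdom (ip_form ip) x -> 0 <= ip_form ip x x.
Proof. by move=> _; exact: dnorm_ge0. Qed.

Lemma ipC x y : ip x y = Num.conj (ip y x).
Proof. by have := qformC ip_formH (x := x) (y := y) I I. Qed.

Lemma ipDl x y z : ip (x + y) z = ip x z + ip y z.
Proof. exact: (qformDl ip_formH (x := x) (y := y) I I I). Qed.
Lemma ipNl x z : ip (- x) z = - ip x z.
Proof. exact: (qformNl ip_formH (x := x) I I). Qed.
Lemma ipBl x y z : ip (x - y) z = ip x z - ip y z.
Proof. exact: (qformBl ip_formH (x := x) (y := y) I I I). Qed.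
Lemma ipZl c x z : ip (c *: x) z = c * ip x z.
Proof. exact: (qformZl ip_formH c (x := x) I I). Qed.
Lemma ipDr x y z : ip x (y + z) = ip x y + ip x z.
Proof. exact: (qformDr ip_formH (x := x) (y := y) (z := z) I I I). Qed.
Lemma ipBr x y z : ip x (y - z) = ip x y - ip x z.
Proof. exact: (qformBr ip_formH (x := x) (y := y) (z := z) I I I). Qed.
Lemma ipZr c x y : ip x (c *: y) = Num.conj c * ip x y.
Proof. exact: (qformZr ip_formH c (x := x) (y := y) I I). Qed.
Lemma ip0l x : ip 0 x = 0.
Proof. by have := ipBl 0 0 x; rewrite !subrr. Qed.
Lemma ip0r x : ip x 0 = 0.
Proof. by have := ipBr x 0 0; rewrite !subrr. Qed.

(** Deliberately weaker than [inner_product_norm], so as to cover [dsum_ip] on the product with its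
    maximum norm. *)
Definition ip_continuous : Prop :=
  forall w, exists2 C : R, 0 <= C & forall x, normc (ip x w) <= C * rnorm x.

Hypothesis ip_cont : ip_continuous.

Lemma dense_ip_eq (S : set H) y z : dense S ->
  (forall x, S x -> ip x y = ip x z) -> y = z.
Proof.
move=> /denseP dS yz; apply/eqP; rewrite -subr_eq0; apply: contraT => w0.
set w := y - z in w0; have [C C0 wC] := ip_cont w.
have : 0 < ip w w by rewrite dnorm_gt0.
have /eq0_normc -> : normc (ip w w) = 0; last by rewrite ltxx.
apply/eqP; rewrite eq_le normc_ge0 andbT.
apply: (le0_eps C0) => e e0; have [s Ss ws] := dS w e e0.
have -> : ip w w = ip (w - s) w.
  rewrite (ipBl w s); suff -> : ip s w = 0 by rewrite subr0.
  by rewrite /w ipBr yz // subrr.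
by rewrite (le_trans (wC _)) // ler_wpM2l // ltW.
Qed.

End InnerProduct.

Section HilbertNorm.
Variables (R : realType) (H : normedModType R[i]) (ip : {dot H for Num.conj}).
Hypothesis nip : inner_product_norm ip.

Lemma sqform_ip x : sqform (ip_form ip) x = rnorm x.
Proof.
by rewrite /sqform /= nip rnormE -rmorphXn /= sqrtr_sqr ger0_norm ?rnorm_ge0.
Qed.

Lemma ip_normE x : ip x x = (rnorm x ^+ 2)%:C.
Proof. by rewrite nip rnormE -rmorphXn. Qed.

Lemma cauchy_schwarz x y : normc (ip x y) <= rnorm x * rnorm y.
Proof.
rewrite -!sqform_ip.
exact: (@cauchy_schwarz_form _ _ _ (ip_formH ip) (@ip_form_pos _ _ ip)).
Qed.

Lemma hilbert_ip_continuous : ip_continuous ip.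
Proof.
move=> w; exists (rnorm w); first exact: rnorm_ge0.
by move=> x; rewrite mulrC cauchy_schwarz.
Qed.

(** Test with [s] in [S] close to [w] itself, where [ip s w] is close to [rnorm w ^+ 2]. This
    converts bounds on functionals into bounds on vectors. *)
Lemma dense_ip_bound (S : set H) w (M : R) : dense S -> 0 <= M ->
  (forall x, S x -> normc (ip x w) <= M * rnorm x) -> rnorm w <= M.
Proof.
move=> /denseP dS M0 wM.
have [w0|w0] := eqVneq (rnorm w) 0; first by rewrite w0.
have {}w0 : 0 < rnorm w by rewrite lt_def w0 rnorm_ge0.
rewrite -(ler_pM2r w0) -expr2.
have -> : rnorm w ^+ 2 = normc (ip w w).
  by rewrite ip_normE normcC ger0_norm ?sqr_ge0.
rewrite -subr_le0; apply: (@le0_eps _ _ (rnorm w + M)).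
  by rewrite addr_ge0 ?rnorm_ge0.
move=> e e0; have [s Ss ws] := dS w e e0.
have : normc (ip w w) <= normc (ip (w - s) w) + normc (ip s w).
  by rewrite (le_trans _ (normcD _ _)) // ipBl subrK.
have := cauchy_schwarz (w - s) w; have := wM _ Ss.
have : M * rnorm s <= M * (rnorm w + e).
  rewrite ler_wpM2l //; have := rnormD (- (w - s)) w.
  by rewrite opprB subrK rnormB; move: ws; lra.
have : rnorm (w - s) * rnorm w <= e * rnorm w by rewrite ler_wpM2r ?ltW.
lra.
Qed.

End HilbertNorm.

Lemma hilbert_complete (R : realType) (H : completeNormedModType R[i])
    (ip : {dot H for Num.conj}) :
  inner_product_norm ip -> complete_form (ip_form ip).
Proof.
move=> nip u _ cu.
have /cauchy_cvgP/cvg_ex[x ux] : cauchy (u @ \oo).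
  apply/cauchy_ballP => _ /gt0_complexP[e e0 ->].
  have [k kP] := cu e e0; rewrite near_map2.
  exists ([set n | (k <= n)%N], [set n | (k <= n)%N]).
    by split; exists k.
  move=> [m n] [/= km kn]; rewrite -ball_normE /= rnorm_lt.
  by have := kP _ _ km kn; rewrite sqform_ip.
exists x => // e e0.
have e0' : 0 < e%:C by rewrite ltcR.
have /cvgrPdist_lt/(_ _ e0')[k _ kP] := ux.
by exists k => n /kP /=; rewrite sqform_ip // rnormB rnorm_lt.
Qed.

Section Adjoint.
Variables (R : realType) (U V : normedModType R[i]).
Variables (ipU : {dot U for Num.conj}) (ipV : {dot V for Num.conj}).
Hypotheses (cU : ip_continuous ipU) (cV : ip_continuous ipV).
Variable T : partop U V.
Local Notation T' := (adjoint ipU ipV T).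

Lemma adjointE x y : dom T x -> dom T' y -> ipV (T x) y = ipU x (T' y).
Proof.
move=> Tx [z hz];
  have : exists z, forall x, dom T x -> ipV (T x) y = ipU x z by exists z.
by move=> /(@getPex _ [set z | forall x, dom T x -> ipV (T x) y = ipU x z]);
  apply.
Qed.

Lemma adjoint_unique y z : dense (dom T) ->
  (forall x, dom T x -> ipV (T x) y = ipU x z) -> dom T' y /\ T' y = z.
Proof.
move=> dT hz; have T'y : dom T' y by exists z.
by split=> //; apply: (dense_ip_eq cU dT) => x Tx; rewrite -adjointE // hz.
Qed.

Lemma adjoint_linear : dense (dom T) -> linear_op T'.
Proof.
move=> dT; split; first by exists 0 => x _; rewrite !ip0r.
move=> c x y T'x T'y; apply: adjoint_unique => // z Tz.
by rewrite !ipDr !ipZr !adjointE.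
Qed.

Lemma closure_adjoint x y z : dom T x -> closure (graph T') (y, z) ->
  ipV (T x) y = ipU x z.
Proof.
move=> Tx /closure_graphP clT.
apply/eqP; rewrite -subr_eq0; apply/eqP/eq0_normc/eqP.
rewrite eq_le normc_ge0 andbT.
have [C1 C10 h1] := cV (T x); have [C2 C20 h2] := cU x.
apply: (@le0_eps _ _ (C1 + C2)); first by rewrite addr_ge0.
move=> e e0; have [y' T'y' [yy' zz']] := clT e e0.
have -> : ipV (T x) y - ipU x z = ipV (T x) (y - y') - ipU x (z - T' y').
  by rewrite !ipBr (adjointE Tx T'y') opprB addrA subrK.
rewrite (le_trans (normcD _ _)) // normcN mulrDl lerD //.
  by rewrite ipC normc_conj (le_trans (h1 _)) // ler_wpM2l // ltW.
by rewrite ipC normc_conj (le_trans (h2 _)) // ler_wpM2l // ltW.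
Qed.

End Adjoint.

Section SelfAdjoint.
Variables (R : realType) (H : normedModType R[i]) (ip : {dot H for Num.conj}).
Hypothesis ip_cont : ip_continuous ip.
Variable T : partop H H.

(** The adjoint takes its values by [get]; symmetry and maximality replace it by conditions on [T]
    alone. *)
Lemma selfadjointI : dense (dom T) ->
  (forall x y, dom T x -> dom T y -> ip (T x) y = ip x (T y)) ->
  (forall y z, (forall x, dom T x -> ip (T x) y = ip x z) ->
     dom T y /\ T y = z) -> selfadjoint ip T.
Proof.
move=> dT sym maxT; split=> //; apply/op_eqP; split=> [|x [y xy]].
  apply/seteqP; split=> x; first by move=> Tx; exists (T x) => y Ty; exact: sym.
  by move=> [y /maxT[]].
have [Tx ->] := maxT _ _ xy.
by have [_ ->] := adjoint_unique ip_cont dT xy.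
Qed.

Hypothesis saT : selfadjoint ip T.

Lemma sa_sym x y : dom T x -> dom T y -> ip (T x) y = ip x (T y).
Proof.
case: saT => _ /op_eqP[dT TT'] Tx Ty; rewrite (TT' y) -?dT //.
by apply: adjointE; rewrite -?dT.
Qed.

Lemma sa_max y z : (forall x, dom T x -> ip (T x) y = ip x z) ->
  dom T y /\ T y = z.
Proof.
case: saT => dns /op_eqP[dT TT'] h;
  have [T'y <-] := adjoint_unique ip_cont dns h.
by rewrite TT' // dT.
Qed.

Lemma sa_linear : linear_op T.
Proof.
split; first by have [] := sa_max (y := 0) (z := 0) _ => // x _; rewrite !ip0r.
move=> c x y Tx Ty; apply: sa_max => z Tz.
by rewrite !ipDr !ipZr !sa_sym.
Qed.

Lemma sa_closure x y : closure (graph T) (x, y) -> dom T x /\ T x = y.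
Proof.
move=> h; apply: sa_max => z Tz; apply: (closure_adjoint ip_cont ip_cont Tz).
by case: saT => _ <-.
Qed.

End SelfAdjoint.

Section LinearOp.
Variables (R : realType) (U V : normedModType R[i]) (T : partop U V).
Hypothesis lT : linear_op T.

Lemma dom_lin0 : dom T 0. Proof. by case: lT. Qed.
Lemma dom_linZ c x : dom T x -> dom T (c *: x).
Proof. by move=> Tx; have [] := lT.2 c x 0 Tx dom_lin0; rewrite addr0. Qed.
Lemma dom_linD x y : dom T x -> dom T y -> dom T (x + y).
Proof. by move=> Tx Ty; have [] := lT.2 1 x y Tx Ty; rewrite scale1r. Qed.
Lemma dom_linB x y : dom T x -> dom T y -> dom T (x - y).
Proof.
by move=> Tx Ty; have [] := lT.2 (-1) y x Ty Tx; rewrite scaleN1r addrC.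
Qed.
Lemma op_linD x y : dom T x -> dom T y -> T (x + y) = T x + T y.
Proof. by move=> Tx Ty; have [_] := lT.2 1 x y Tx Ty; rewrite !scale1r. Qed.
Lemma op_lin0 : T 0 = 0.
Proof.
by have := op_linD dom_lin0 dom_lin0; rewrite addr0 -[LHS]addr0 => /addrI.
Qed.
Lemma op_linZ c x : dom T x -> T (c *: x) = c *: T x.
Proof.
by move=> Tx; have [_] := lT.2 c x 0 Tx dom_lin0; rewrite op_lin0 !addr0.
Qed.
Lemma op_linB x y : dom T x -> dom T y -> T (x - y) = T x - T y.
Proof.
by move=> Tx Ty; have [_] := lT.2 (-1) y x Ty Tx;
  rewrite !scaleN1r addrC => ->; rewrite addrC.
Qed.

End LinearOp.

(** * Forms associated with semibounded operators *)

(* Cauchy-Schwarz for the nonnegative form of [c2 - T] bounds [T], and a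
   bounded closed densely defined operator is defined everywhere. *)
Lemma sa_bounded_total (R : realType) (H : completeNormedModType R[i])
    (ip : {dot H for Num.conj}) (T : partop H H) (c1 c2 : R) :
  inner_product_norm ip -> selfadjoint ip T ->
  (forall x, dom T x -> c1%:C * ip x x <= ip (T x) x) ->
  (forall x, dom T x -> ip (T x) x <= c2%:C * ip x x) -> dom T = setT.
Proof.
move=> nip saT Tc1 Tc2.
have cip := hilbert_ip_continuous nip.
have lT := sa_linear cip saT; have sT := sa_sym saT.
pose S x := c2%:C *: x - T x.
pose s := Qform (dom T) (fun x y => ip (S x) y).
have hs : hermitian_form s.
  split=> /= [|c x y|c x y z Tx Ty Tz|x y Tx Ty].
  - exact: dom_lin0 lT.
  - by move=> Tx Ty; have [] := lT.2 c x y Tx Ty.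
  - rewrite -ipZl -ipDl /S; congr (ip _ z); have [_ ->] := lT.2 c x y Tx Ty.
    by rewrite scalerDr scalerBr opprD addrACA !scalerA mulrC.
  - by rewrite -ipC ipBr ipBl ipZl ipZr conj_real sT.
have poss x : dom T x -> 0 <= ip (S x) x.
  by move=> Tx; rewrite ipBl ipZl subr_ge0 Tc2.
(* On the diagonal [s] lies between 0 and [(c2 - c1) * rnorm x ^+ 2]; the absolute value spares a
   comparison of [c1] with [c2]. *)
pose M : R := Num.sqrt `|c2 - c1|.
have sM x : dom T x -> sqform s x <= M * rnorm x.
  move=> Tx; have r0 : 0 <= rnorm x := rnorm_ge0 x.
  rewrite -[rnorm x]ger0_norm // -sqrtr_sqr -sqrtrM //.
  rewrite ler_sqrt; last by rewrite mulr_ge0 ?sqr_ge0.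
  have : ip (S x) x <= ((c2 - c1) * rnorm x ^+ 2)%:C.
    have -> : ((c2 - c1) * rnorm x ^+ 2)%:C = (c2%:C - c1%:C) * ip x x.
      by rewrite ip_normE // -rmorphB -rmorphM.
    by rewrite ipBl ipZl mulrBl lerB // Tc1.
  rewrite lecE => /andP[_ /= h]; apply: (le_trans h).
  by rewrite ler_wpM2r ?sqr_ge0 // ler_norm.
have dT : dense (dom T) by case: saT.
have M0 : 0 <= M by exact: sqrtr_ge0.
have T_bounded (v : H) : dom T v -> rnorm (T v) <= (`|c2| + M * M) * rnorm v.
  move: v => x Tx;
  have -> : T x = c2%:C *: x - S x by rewrite /S opprB addrC subrK.
  rewrite (le_trans (rnormD _ _)) // rnormN rnormZ normcC mulrDl lerD2l.
  apply: (dense_ip_bound nip dT); first by rewrite !mulr_ge0 ?rnorm_ge0.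
  move=> z Tz; rewrite ipC normc_conj.
  apply: (le_trans (cauchy_schwarz_form hs poss Tx Tz)).
  rewrite [leRHS](_ : _ = (M * rnorm x) * (M * rnorm z)); last by ring.
  by rewrite ler_pM ?sqform_ge0 ?sM.
have C0 : 0 < `|c2| + M * M + 1 by rewrite ltr_wpDl // addr_ge0 ?mulr_ge0.
apply/seteqP; split=> // y _.
have /choice[u uP] n : exists x, dom T x /\ rnorm (y - x) < n.+1%:R^-1.
  have /denseP/(_ y n.+1%:R^-1)[|x Tx xy] := dT; last by exists x.
  by rewrite invr_gt0 ltr0Sn.
have Tu n := (uP n).1.
have [||z _ zu] := hilbert_complete nip (u := fun n => T (u n)).
- by [].
- move=> e e0.
  have e2 : 0 < e / (`|c2| + M * M + 1) / 2 by rewrite !divr_gt0.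
  have [k kP] := ex_inv_natS_lt e2.
  exists k => m n km kn; rewrite sqform_ip // -(op_linB lT) //.
  apply: (le_lt_trans (T_bounded _ (dom_linB lT (Tu m) (Tu n)))).
  have um : rnorm (u m - u n) < e / (`|c2| + M * M + 1).
    rewrite [ltRHS]splitr
      (@le_lt_trans _ _ (rnorm (y - u m) + rnorm (y - u n))) //.
      by rewrite [rnorm (y - u m)]rnormB (le_trans _ (rnormD _ _)) //
        addrA subrK.
    by rewrite ltrD // (lt_trans (uP _).2) // kP.
  move: um; rewrite ltr_pdivlMr // mulrC; apply: le_lt_trans.
  by rewrite ler_wpM2r ?rnorm_ge0 // lerDl.
have [|//] := sa_closure cip saT (x := y) (y := z).
apply/closure_graphP => e e0.
have [k1 k1P] := ex_inv_natS_lt e0; have [k2 k2P] := zu e e0.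
exists (u (maxn k1 k2)) => //; split.
  by rewrite (lt_trans (uP _).2) // k1P // leq_maxl.
by rewrite rnormB -(sqform_ip nip) k2P // leq_maxr.
Qed.

Section AssociatedForm.
Variables (R : realType) (H : completeNormedModType R[i]).
Variables (ip : {dot H for Num.conj}) (A : partop H H) (a : qform H).
Hypotheses (nip : inner_product_norm ip) (saA : selfadjoint ip A).
Hypotheses (bddA : bounded_from_below ip A) (assA : associated_form ip A a).

Lemma assoc_hermitian : hermitian_form a. Proof. by case: assA => -[]. Qed.

Lemma assocE x y : dom A x -> fdom a y -> a x y = ip (A x) y.
Proof.
case: assA => -[_ _ _ _ gA] _ Ax ay.
have : graph A (x, A x) by [].
by rewrite gA => -[/= _]; apply.
Qed.

Lemma assoc_dom x : dom A x -> fdom a x.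
Proof.
case: assA => -[_ _ _ _ gA] _ Ax.
have : graph A (x, A x) by [].
by rewrite gA => -[].
Qed.

Lemma assoc_max x w : fdom a x -> (forall y, fdom a y -> a x y = ip w y) ->
  dom A x /\ A x = w.
Proof.
case: assA => -[_ _ _ _ gA] _ ax xw.
have : graph A (x, w) by rewrite gA.
by case.
Qed.

(** If the form is bounded from above, then [A] is bounded on both sides, hence defined everywhere,
    and the lower bound of [A] is one for [a]. *)
Lemma assoc_bounded_below : exists c : R, forall x, fdom a x ->
  c%:C * ip x x <= a x x.
Proof.
case: assA => -[_ [c [lo|up]] _ _ _] _; first by exists c.
have [c' loA] := bddA; exists c' => x ax.
have Ax : dom A x.
  rewrite (sa_bounded_total nip saA loA (c2 := c)) // => y Ay.
  by rewrite -assocE ?up //; exact: assoc_dom.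
by rewrite assocE // loA.
Qed.

Variable c : R.
Hypothesis ac : forall x, fdom a x -> c%:C * ip x x <= a x x.

Definition shift_form (nu : R) : qform H :=
  Qform (fdom a) (fun x y => a x y - nu%:C * ip x y).

Lemma shift_form_hermitian nu : hermitian_form (shift_form nu).
Proof.
have [a0 aL al aC] := assoc_hermitian;
  split=> //= [c' x y z ax ay az|x y ax ay].
  by rewrite al // ipDl ipZl; ring.
by rewrite rmorphB rmorphM /= conj_real -aC // -ipC.
Qed.

Local Notation t := (shift_form (c - 1)).

(** Shifting by [c - 1] instead of [c] leaves one full copy of the inner product; it makes the form
    norm definite and stronger than the norm of [H]. *)
Lemma shift_form_coercive x : fdom a x -> ip x x <= t x x.
Proof. by move=> ax /=; rewrite rmorphB /= rmorph1 mulrBl mul1r opprB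
  addrCA lerDl subr_ge0 ac. Qed.

Lemma shift_form_pos x : fdom t x -> 0 <= t x x.
Proof. by move=> /shift_form_coercive; apply: le_trans; exact: dnorm_ge0. Qed.

Lemma rnorm_le_sqform x : fdom a x -> rnorm x <= sqform t x.
Proof.
move=> ax; rewrite -(@ler_pXn2r _ 2) ?nnegrE ?rnorm_ge0 ?sqform_ge0 //.
by rewrite -lecR -(ip_normE nip) -(sqformE shift_form_pos) //
  shift_form_coercive.
Qed.

Let form_eq x : fdom a x ->
  a x x = (sqform t x ^+ 2 + (c - 1) * rnorm x ^+ 2)%:C.
Proof.
move=> ax; have -> : (sqform t x ^+ 2 + (c - 1) * rnorm x ^+ 2)%:C =
  t x x + (c - 1)%:C * ip x x.
  by rewrite (sqformE shift_form_pos) // ip_normE // -rmorphM -rmorphD.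
by rewrite /= subrK.
Qed.

Let form_le x : fdom a x -> normc (a x x) <= (`|c - 1| + 1) * sqform t x ^+ 2.
Proof.
move=> ax; rewrite form_eq // normcC (le_trans (ler_normD _ _)) //.
rewrite [leRHS]mulrDl mul1r addrC normrM.
have r0 : 0 <= rnorm x := rnorm_ge0 _;
  have s0 : 0 <= sqform t x := sqform_ge0 _ _.
rewrite (ger0_norm (sqr_ge0 (rnorm x))) (ger0_norm (sqr_ge0 (sqform t x)))
  lerD2r.
by rewrite ler_wpM2l // ler_pXn2r ?nnegrE // rnorm_le_sqform.
Qed.

(** By coercivity a Cauchy sequence for [t] converges in [H]. Kato's closedness then puts the limit
    into the form domain and sends [a] of the differences to 0; [t] differs from [a] by a multiple
    of the squared norm, which also tends to 0. *)
Lemma shift_form_complete : complete_form t.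
Proof.
have ht := shift_form_hermitian (c - 1).
case: assA => -[_ _ _ cla _] _ u au cu.
have c0 : 0 < `|c - 1| + 1 by rewrite ltr_wpDl.
have [//|e e0|x _ xu] := hilbert_complete nip (u := u).
  have [k kP] := cu e e0; exists k => m n km kn.
  rewrite sqform_ip // (le_lt_trans _ (kP m n km kn)) // rnorm_le_sqform //.
  exact: (fdomB ht).
have [//|||ax xa] := cla u x.
- apply/cvgrPdist_lt => _ /gt0_complexP[e e0 ->].
  have [k kP] := xu e e0; exists k => // n /= kn.
  by rewrite rnorm_lt rnormB -(sqform_ip nip) kP.
- move=> e e0.
  have d0 : 0 < Num.sqrt (e / (`|c - 1| + 1)) by rewrite sqrtr_gt0 divr_gt0.
  have [k kP] := cu _ d0; exists k => m n km kn.
  have amn : fdom a (u m - u n) by exact: (fdomB ht).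
  have nE (z : R[i]) : `|z| = (normc z)%:C by [].
  rewrite nE ltcR (le_lt_trans (form_le amn)) // mulrC -ltr_pdivlMr //.
  rewrite -[ltRHS]sqr_sqrtr ?divr_ge0 ?(ltW e0) ?(ltW c0) //.
  by rewrite ltr_pXn2r ?nnegrE ?sqform_ge0 ?sqrtr_ge0 // kP.
exists x => // e e0.
(* One half of [e ^+ 2] is for [a], the other for the multiple of the squared norm. *)
have e2 : 0 < e ^+ 2 / 2 by rewrite divr_gt0 ?exprn_gt0.
have e2' : 0 < (e ^+ 2 / 2)%:C by rewrite ltcR.
have /cvgrPdist_lt/(_ _ e2')[k1 _ k1P] := xa.
have d0 : 0 < e ^+ 2 / 2 / (`|c - 1| + 1) by rewrite divr_gt0.
have d0' : 0 < Num.sqrt (e ^+ 2 / 2 / (`|c - 1| + 1)) by rewrite sqrtr_gt0.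
have [k2 k2P] := xu _ d0'.
exists (maxn k1 k2) => n; rewrite geq_max => /andP[kn1 kn2].
have anx : fdom a (u n - x) by exact: (fdomB ht).
rewrite -(@ltr_pXn2r _ 2) ?nnegrE ?sqform_ge0 ?(ltW e0) //.
have := k1P n kn1; rewrite /= sub0r normrN form_eq //.
have -> : `|(sqform t (u n - x) ^+ 2 + (c - 1) * rnorm (u n - x) ^+ 2)%:C| =
  (`|sqform t (u n - x) ^+ 2 + (c - 1) * rnorm (u n - x) ^+ 2|)%:C.
  by rewrite -normcC.
rewrite ltcR.
have h1 : rnorm (u n - x) ^+ 2 * (`|c - 1| + 1) < e ^+ 2 / 2.
  rewrite -ltr_pdivlMr // -[ltRHS](sqr_sqrtr (ltW d0)).
  rewrite ltr_pXn2r ?nnegrE ?rnorm_ge0 ?sqrtr_ge0 //.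
  by rewrite -(sqform_ip nip) k2P.
move: h1; set r2 := rnorm _ ^+ 2; set s2 := sqform _ _ ^+ 2 => h1 h2.
have r20 : 0 <= r2 by exact: sqr_ge0.
have h3 : `|(c - 1) * r2| < e ^+ 2 / 2.
  by rewrite normrM (ger0_norm r20) mulrC (le_lt_trans _ h1) //
    ler_wpM2l // lerDl.
have := ler_norm (s2 + (c - 1) * r2).
have := ler_norm (- ((c - 1) * r2)); rewrite normrN.
by rewrite [X in _ < X]splitr => *; lra.
Qed.

End AssociatedForm.

(** * The coupling operator *)

(* [K y] represents [z |-> <y, B^* z>] in the form [a - nu]; thus [K] extends
   [(A - nu)^-1 B] to all of [H2]. *)
Record coupling (R : realType) (H1 H2 : normedModType R[i])
    (ip1 : {dot H1 for Num.conj}) (ip2 : {dot H2 for Num.conj})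
    (a : qform H1) (B : partop H2 H1) (nu C : R) (K : H2 -> H1) : Prop :=
  Coupling {
    coupling_dom : forall y, fdom a (K y);
    coupling_form : forall y x, fdom a x ->
      a (K y) x - nu%:C * ip1 (K y) x = ip2 y (adjoint ip2 ip1 B x);
    coupling_linear : forall c y z, K (c *: y + z) = c *: K y + K z;
    coupling_ge0 : 0 <= C;
    coupling_bound : forall y, rnorm (K y) <= C * rnorm y;
    coupling_adj_bound : forall y,
      rnorm (adjoint ip2 ip1 B (K y)) <= C * rnorm y }.

Section CouplingExists.
Variables (R : realType) (H1 H2 : completeNormedModType R[i]).
Variables (ip1 : {dot H1 for Num.conj}) (ip2 : {dot H2 for Num.conj}).
Variables (A : partop H1 H1) (B : partop H2 H1) (a : qform H1) (c : R).
Hypotheses (n1 : inner_product_norm ip1) (n2 : inner_product_norm ip2).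
Hypotheses (dB : dense (dom B)) (assA : associated_form ip1 A a).
Hypothesis ac : forall x, fdom a x -> c%:C * ip1 x x <= a x x.
Local Notation B' := (adjoint ip2 ip1 B).
Hypothesis aB : fdom a `<=` dom B'.
Local Notation t := (shift_form ip1 a (c - 1)).

Let c1 := hilbert_ip_continuous n1.
Let c2 := hilbert_ip_continuous n2.
Let lB' : linear_op B' := adjoint_linear ip1 c2 dB.
Let ht : hermitian_form t := shift_form_hermitian assA _.
Let post x : fdom t x -> 0 <= t x x := shift_form_pos ac (x := x).

(* For fixed [y] in [dom B] the functional [x |-> <y, B^* x> = <B y, x>] is
   bounded, and these functionals are pointwise bounded for [y] in the unit
   ball. *)
Lemma adjoint_form_bounded : exists2 C : R, 0 <= C &
  forall x, fdom a x -> rnorm (B' x) <= C * sqform t x.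
Proof.
(* Dividing by the norm normalises [y]; for [y = 0] the quotient is 0, because the inverse of 0 is
   0. *)
pose p (y : {y | dom B y}) x := normc (ip2 (sval y) (B' x)) / rnorm (sval y).
have [y x z ax az|y r x ax|[y By]|x ax|C hC] :=
    uniform_boundedness (p := p) ht post (shift_form_complete n1 assA ac).
- rewrite /p -mulrDl (op_linD lB'); [|exact: aB|exact: aB].
  by rewrite ler_wpM2r ?invr_ge0 ?rnorm_ge0 // ipDr normcD.
- rewrite /p (op_linZ lB'); last exact: aB.
  by rewrite ipZr normcM conj_real normcC mulrA.
- exists (rnorm (B y) / rnorm y) => x ax; rewrite /p /= mulrAC.
  rewrite ler_wpM2r ?invr_ge0 ?rnorm_ge0 //.
  rewrite -(adjointE By (aB ax)) (le_trans (cauchy_schwarz n1 _ _)) //.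
  by rewrite ler_wpM2l ?rnorm_ge0 // rnorm_le_sqform.
- exists (rnorm (B' x)) => -[y By]; rewrite /p /=.
  have [y0|y0] := eqVneq (rnorm y) 0; first by rewrite y0 invr0 mulr0 rnorm_ge0.
  by rewrite ler_pdivrMr ?lt_def ?y0 ?rnorm_ge0 // mulrC cauchy_schwarz.
exists `|C| => // x ax.
have s0 : 0 <= sqform t x := sqform_ge0 _ _.
apply: (dense_ip_bound n2 dB); first by rewrite mulr_ge0.
move=> y By; have [y0|y0] := eqVneq (rnorm y) 0.
  by rewrite (le_trans (cauchy_schwarz n2 _ _)) // y0 mul0r mulr0.
rewrite -ler_pdivrMr ?lt_def ?y0 ?rnorm_ge0 //.
apply: (le_trans (hC (exist _ y By) x ax)).
by rewrite ler_wpM2r // ler_norm.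
Qed.

(** Riesz in the form domain gives [K y]; definiteness of [t] makes it unique, hence linear in [y].
    Testing with [K y] itself gives [t (K y) (K y) = <y, B' (K y)>], which is at most [C * rnorm y]
    times the form norm of [K y]. *)
Lemma coupling_exists : exists C K, coupling ip1 ip2 a B (c - 1) C K.
Proof.
have [C C0 hC] := adjoint_form_bounded.
have /choice[K KP] y : exists z, fdom a z /\
    forall x, fdom a x -> t z x = ip2 y (B' x).
  have [x z ax az|r x ax||z az tz] := riesz_form
      (l := fun x => ip2 y (B' x)) ht post (shift_form_complete n1 assA ac).
  - by rewrite (op_linD lB') ?ipDr //; exact: aB.
  - by rewrite (op_linZ lB') ?ipZr //; exact: aB.
  - exists (rnorm y * C) => x ax; rewrite (le_trans (cauchy_schwarz n2 _ _)) //.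
    by rewrite -mulrA ler_wpM2l ?rnorm_ge0 // hC.
  - by exists z.
have aK y : fdom a (K y) := (KP y).1.
have tK y x : fdom a x -> t (K y) x = ip2 y (B' x) := (KP y).2 x.
have K_bound y : sqform t (K y) <= C * rnorm y.
  have [->|s0] := eqVneq (sqform t (K y)) 0;
    first by rewrite mulr_ge0 ?rnorm_ge0.
  have {}s0 : 0 < sqform t (K y) by rewrite lt_def s0 sqform_ge0.
  rewrite -(ler_pM2r s0) -expr2.
  have -> : sqform t (K y) ^+ 2 = normc (t (K y) (K y)).
    rewrite (sqformE post); last exact: aK.
    by rewrite normcC ger0_norm ?sqr_ge0.
  rewrite tK // (le_trans (cauchy_schwarz n2 _ _)) // -mulrA mulrCA.
  by rewrite ler_wpM2l ?rnorm_ge0 // hC.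
(* [C] bounds [K] and [C * C] bounds [B' K]; the sum serves both. *)
exists (C + C * C), K; split => //.
- move=> r y z; apply/eqP; rewrite -subr_eq0; apply/eqP.
  set w := _ - _; have aw : fdom a w.
    by apply: (fdomB ht); [|apply: (fdomL ht)]; exact: aK.
  apply: rnorm_eq0; apply/eqP; rewrite eq_le rnorm_ge0 andbT.
  rewrite (le_trans (rnorm_le_sqform n1 ac aw)) // /sqform.
  suff -> : t w w = 0 by rewrite sqrtr0.
  have aL : fdom t (r *: K y + K z) by apply: (fdomL ht); exact: aK.
  rewrite {1}/w (qformBl ht) ?(qformL ht) //; try exact: aK.
  by rewrite !tK // ipDl ipZl subrr.
- by rewrite addr_ge0 ?mulr_ge0.
- move=> y; rewrite (le_trans (rnorm_le_sqform n1 ac (aK y))) //.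
  by rewrite (le_trans (K_bound y)) // mulrDl lerDl !mulr_ge0 ?rnorm_ge0.
- move=> y; rewrite (le_trans (hC _ (aK y))) //.
  rewrite mulrDl -mulrA (le_trans (ler_wpM2l C0 (K_bound y))) //.
  by rewrite lerDr mulr_ge0 ?rnorm_ge0.
Qed.

End CouplingExists.

(** * The Schur complement *)

Section DirectSumOperators.
Variables (R : realType) (H1 H2 : normedModType R[i]).
Variables (ip1 : {dot H1 for Num.conj}) (ip2 : {dot H2 for Num.conj}).

Lemma dsum_ip_continuous : ip_continuous ip1 -> ip_continuous ip2 ->
  @ip_continuous R (H1 * H2)%type (dsum_ip ip1 ip2).
Proof.
move=> c1 c2 [w1 w2]; have [C1 C10 h1] := c1 w1; have [C2 C20 h2] := c2 w2.
exists (C1 + C2); first by rewrite addr_ge0.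
move=> p; rewrite (le_trans (normcD _ _)) // mulrDl lerD //=.
  by rewrite (le_trans (h1 _)) // ler_wpM2l // rnorm_pair le_max lexx.
by rewrite (le_trans (h2 _)) // ler_wpM2l // rnorm_pair le_max lexx orbT.
Qed.

(** [J] is an isometric involution for the maximum norm, so it commutes with closing graphs. *)
Lemma closure_graph_J (T : partop (H1 * H2)%type (H1 * H2)%type) p q :
  closure (graph (comp_op (@J_op R H1 H2) T)) (p, q) <->
  closure (graph T) (p, (q.1, - q.2)).
Proof.
have sym (v w : H1 * H2) : rnorm (v - (w.1, - w.2)) = rnorm ((v.1, - v.2) - w).
  by rewrite !rnorm_pair /= opprK -[rnorm (- v.2 - _)]rnormN opprD !opprK.
split=> /closure_graphP clT; apply/closure_graphP => e /clT[p' Tp' [pp' qq']].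
  exists p'; first by case: Tp'.
  split; first exact: pp'.
  rewrite -(sym q (T p')).
  exact: qq'.
exists p'; first by split.
split; first exact: pp'.
rewrite (sym q (T p')).
exact: qq'.
Qed.

End DirectSumOperators.

Section SchurComplement.
Variables (R : realType) (H1 H2 : completeNormedModType R[i]).
Variables (ip1 : {dot H1 for Num.conj}) (ip2 : {dot H2 for Num.conj}).
Variables (A : partop H1 H1) (B : partop H2 H1) (D : partop H2 H2).
Variables (a : qform H1) (nu C : R) (K : H2 -> H1).
Hypotheses (n1 : inner_product_norm ip1) (n2 : inner_product_norm ip2).
Hypotheses (saA : selfadjoint ip1 A) (saD : selfadjoint ip2 D).
Hypotheses (dB : dense (dom B)) (assA : associated_form ip1 A a).
Local Notation B' := (adjoint ip2 ip1 B).
Hypothesis aB : fdom a `<=` dom B'.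
Hypothesis cK : coupling ip1 ip2 a B nu C K.
Local Notation ip := (dsum_ip ip1 ip2).

Let c1 := hilbert_ip_continuous n1.
Let c2 := hilbert_ip_continuous n2.
Let cip := dsum_ip_continuous c1 c2.
Let lA : linear_op A := sa_linear c1 saA.
Let lD : linear_op D := sa_linear c2 saD.
Let lB' : linear_op B' := adjoint_linear ip1 c2 dB.
Let ha : hermitian_form a := assoc_hermitian assA.

Lemma couplingB y z : K (y - z) = K y - K z.
Proof.
by have := coupling_linear cK (-1) z y; rewrite !scaleN1r addrC => ->;
  rewrite addrC.
Qed.

Lemma coupling0 : K 0 = 0.
Proof. by have := couplingB 0 0; rewrite !subrr. Qed.

(** For such [y], [<y, B' x> = <B y, x>], so [K y] solves [(A - nu) u = B y] weakly; the
    representation theorem puts it into [dom A]. *)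
Lemma coupling_on_dom y : dom B y ->
  dom A (K y) /\ A (K y) = B y + nu%:C *: K y.
Proof.
move=> By; apply: (assoc_max assA (coupling_dom cK y)) => x ax.
rewrite ipDl ipZl (adjointE By (aB ax)) -(coupling_form cK) //.
by rewrite subrK.
Qed.

Let dom_adj x y : dom A (x + K y) -> dom B' x.
Proof.
move=> Au; apply: aB; rewrite -(addrK (K y) x).
by apply: (fdomB ha); [exact: (assoc_dom assA)|exact: (coupling_dom cK)].
Qed.

Let ip_A_K x y : dom A x ->
  ip1 (A x) (K y) = ip2 (B' x) y + nu%:C * ip1 x (K y).
Proof.
move=> Ax; have ax := assoc_dom assA Ax; have aK := coupling_dom cK y.
rewrite -(assocE assA) // (qformC ha) //.
rewrite -[a _ _](subrK (nu%:C * ip1 (K y) x)) (coupling_form cK) //.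
by rewrite rmorphD rmorphM /= conj_real -!ipC.
Qed.

(** Both sides are the form [a - nu] evaluated at [K y] and [K z]. *)
Let ip_adj_K y z : ip2 (B' (K y)) z = ip2 y (B' (K z)).
Proof.
have [ay az] := (coupling_dom cK y, coupling_dom cK z).
rewrite ipC -!(coupling_form cK) // rmorphB rmorphM /= conj_real.
by rewrite -(qformC ha) // -ipC.
Qed.

(* The closure of the block operator: the Schur factorisation with respect to
   the bounded triangular map [(x, y) |-> (x + K y, y)]. *)
Definition schur_op : partop (H1 * H2)%type (H1 * H2)%type :=
  Partop [set p | dom D p.2 /\ dom A (p.1 + K p.2)]
    (fun p => (A (p.1 + K p.2) - nu%:C *: K p.2, - B' p.1 + D p.2)).

Local Notation Jop := (comp_op (@J_op R H1 H2) schur_op).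

(** In the variables [x + K y] and [x' + K y'] every term is either Hermitian by itself or paired
    with its mirror image, so symmetry can be read off. The formula holds for all [x'], [y'], as the
    adjoint relation demands. *)
Let ip_Jop x y x' y' : dom D y -> dom A (x + K y) ->
  ip (Jop (x, y)) (x', y') =
    ip1 (A (x + K y)) (x' + K y') - nu%:C * ip1 (x + K y) (K y')
    - nu%:C * ip1 (K y) (x' + K y') + nu%:C * ip1 (K y) (K y')
    - ip2 (B' (K y)) y' - ip2 (D y) y'.
Proof.
move=> Dy Au.
have -> : ip (Jop (x, y)) (x', y') =
    ip1 (A (x + K y) - nu%:C *: K y) x' + ip2 (- (- B' x + D y)) y' by [].
rewrite opprD opprK.
have -> : B' x = B' (x + K y) - B' (K y).
  rewrite -(op_linB lB') ?addrK //; first exact/aB/(assoc_dom assA).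
  exact/aB/(coupling_dom cK).
rewrite [ip1 (A _) (x' + _)]ipDr ip_A_K // !ipBl !ipZl !ipDr.
by ring.
Qed.

(** The domain is the preimage of [dom A] times [dom D] under the homeomorphism sending [(x, y)] to
    [(x + K y, y)]. *)
Lemma schur_op_dense : dense (dom schur_op).
Proof.
have dA : dense (dom A) by case: saA.
have dD : dense (dom D) by case: saD.
apply/denseP => -[x y] e e0.
have C0 := coupling_ge0 cK; have C1 : 0 < C + 1 by rewrite ltr_wpDl.
have e2 : 0 < e / 2 by rewrite divr_gt0.
have d0 : 0 < e / 2 / (C + 1) by rewrite divr_gt0.
have /denseP/(_ y _ d0)[y' Dy' yy'] := dD.
have /denseP/(_ (x + K y) _ e2)[u Au xu] := dA.
exists (u - K y', y'); first by split=> //=; rewrite subrK.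
rewrite rnorm_pair /= gt_max; apply/andP; split; last first.
  rewrite (lt_le_trans yy') // ler_pdivrMr // [leRHS]mulrDr mulr1.
  by rewrite ler_wpDl ?mulr_ge0 ?(ltW e0) //; lra.
have -> : x - (u - K y') = (x + K y - u) - K (y - y').
  by rewrite couplingB !opprB -[RHS]addrA [- u + _]addrA addrACA subrr addr0
    [- u + _]addrC.
rewrite [e]splitr (le_lt_trans (rnormD _ _)) // rnormN ltr_leD //.
rewrite (le_trans (coupling_bound cK _)) //.
move: yy'; rewrite ltr_pdivlMr // mulrC => /ltW; apply: le_trans.
by rewrite ler_wpM2r ?rnorm_ge0 // lerDl.
Qed.

Lemma schur_op_selfadjoint : @selfadjoint R (H1 * H2)%type ip Jop.
Proof.
have domJ : dom Jop = dom schur_op by apply/seteqP; split=> p //= [].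
apply: (selfadjointI cip); first by rewrite domJ; exact: schur_op_dense.
- suff symJ p q : dom schur_op p -> dom schur_op q ->
      ip (Jop p) q = Num.conj (ip (Jop q) p).
    by move=> p q; rewrite domJ => Sp Sq; rewrite [RHS]ipC; exact: symJ.
  move: p q => [x y] [x' y'] [/= Dy Au] [/= Dy' Au'].
  rewrite !ip_Jop // !(conjB, conjD, conjM) conj_real -!ipC.
  rewrite (sa_sym saA) // (sa_sym saD) // ip_adj_K.
  by ring.
move=> [x' y'] [f g] h.
have hp (p : H1 * H2) : dom schur_op p -> ip (Jop p) (x', y') = ip p (f, g).
  by rewrite -domJ => /h.
(* The test vectors [(x, 0)] remove every term with [K y], [B' K y] or [D y]; what remains is the
   adjoint relation for [A]. *)
have [Au' Au'E] : dom A (x' + K y') /\ A (x' + K y') = f + nu%:C *: K y'.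
  apply: (sa_max c1 saA) => x Ax.
  have D0 := dom_lin0 lD; have AK0 : dom A (x + K 0) by rewrite coupling0 addr0.
  have := hp (x, 0) (conj D0 AK0); rewrite ip_Jop //.
  have -> : ip (x, 0) (f, g) = ip1 x f + ip2 0 g by [].
  rewrite coupling0 addr0 (op_lin0 lB') (op_lin0 lD) !ip0l.
  rewrite !mulr0 !subr0 !addr0 => fE.
  by rewrite [RHS]ipDr ipZr conj_real -fE subrK.
(* For the test vectors [(- K y, y)] the sum [x + K y] is 0, so [A] drops out of the left side; on
   the right [f] is replaced by the identity just found. *)
have [Dy' Dy'E] : dom D y' /\ D y' = B' (x' + K y') - B' (K y') - g.
  apply: (sa_max c2 saD) => y Dy.
  have AK : dom A (- K y + K y) by rewrite addNr; exact: dom_lin0 lA.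
  have := hp (- K y, y) (conj Dy AK); rewrite ip_Jop //.
  have -> : ip (- K y, y) (f, g) = ip1 (- K y) f + ip2 y g by [].
  rewrite addNr (op_lin0 lA) !ip0l.
  have -> : f = A (x' + K y') - nu%:C *: K y' by rewrite Au'E addrK.
  rewrite ipNl ipBr [ip1 (K y) (A _)]ipC ip_A_K // conjD conjM conj_real -!ipC.
  rewrite ip_adj_K !ipBr ipZr conj_real => hy.
  apply/eqP; rewrite -subr_eq0; apply/eqP; move/eqP: hy;
    rewrite -subr_eq0 => /eqP hy.
  rewrite -[RHS]oppr0 -hy; ring.
have Sxy : dom schur_op (x', y') by [].
split; first by rewrite domJ.
congr (_, _); first by rewrite /= Au'E addrK.
rewrite -[LHS]/(- (- B' x' + D y')).
have -> : B' x' = B' (x' + K y') - B' (K y').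
  rewrite -(op_linB lB') ?addrK //; first exact/aB/(assoc_dom assA).
  exact/aB/(coupling_dom cK).
by rewrite opprD opprK Dy'E subKr.
Qed.
Lemma closure_schur_op : closure (graph schur_op) = graph schur_op.
Proof.
apply/seteqP; split; last exact: subset_closure.
move=> [p [f g]] cl.
have /(sa_closure cip schur_op_selfadjoint) : closure (graph Jop) (p, (f, - g)).
  by apply/closure_graph_J; rewrite /= opprK.
by case=> -[Sp _] [<- /oppr_inj <-]; split=> //=; case: (p).
Qed.

Local Notation M0 := (block_op A B (opp_op B') D).

Lemma block_op_sub_schur_op : graph M0 `<=` graph schur_op.
Proof.
move=> [[x y] _] [[/= [Ax _] [By Dy]] ->].
have [AK AKE] := coupling_on_dom By.
split=> /=; first by split=> //; exact: (dom_linD lA).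
by rewrite (op_linD lA) // AKE addrA addrK.
Qed.

Lemma closure_block_op_core : dom B `<=` dom D -> core D (dom B) ->
  closure (graph M0) = graph schur_op.
Proof.
move=> BD [_ /op_eqP[domD opD]]; apply/seteqP; split.
  by rewrite -closure_schur_op; apply: closure_subset;
    exact: block_op_sub_schur_op.
move=> [[x y] _] [[/= Dy Au] ->]; apply/closure_graphP => e e0.
have C0 := coupling_ge0 cK.
(* Large enough for all four errors: [C], [1], [|nu| * C] and [C + 1] times the core approximation
   error. *)
pose c := `|nu| * C + C + 1.
have c0 : 0 < c by rewrite ltr_wpDl // addr_ge0 ?mulr_ge0.
have d0 : 0 < e / c by rewrite divr_gt0.
have [y' [Dy' By'] [yy' DD']] : exists2 y', dom D y' /\ dom B y' &
    rnorm (y - y') < e / c /\ rnorm (D y - D y') < e / c.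
  have [z clz] : dom (closure_op (restrict_op D (dom B))) y by rewrite domD.
  by have /closure_graphP/(_ _ d0) := closure_opP clz; rewrite opD.
have [AK AKE] := coupling_on_dom By'.
(* This keeps [x' + K y' = x + K y], so the unbounded term in [A] is reproduced exactly and only
   [nu K (y - y')] is left in the first component. *)
pose x' := x + K y - K y'.
have Ax' : dom A x' by exact: (dom_linB lA).
have ax' := assoc_dom assA Ax'.
have xx' : x - x' = - K (y - y').
  by rewrite couplingB /x' -addrA opprD addrA subrr add0r.
have M0' : dom M0 (x', y') by do !split=> //=; exact/aB/(assoc_dom assA).
have K_small : rnorm (K (y - y')) <= C * (e / c).
  by rewrite (le_trans (coupling_bound cK _)) // ler_wpM2l // ltW.
have cE : e / c * c = e by rewrite divfK // gt_eqF.
have nuC0 : 0 <= `|nu| * C by rewrite mulr_ge0.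
exists (x', y') => //.
have [_ /= ->] : graph schur_op ((x', y'), M0 (x', y'))
  by exact: block_op_sub_schur_op.
rewrite !rnorm_pair !gt_max /= subrK; split; apply/andP; split.
- rewrite xx' rnormN (le_lt_trans K_small) //.
  by rewrite -[ltRHS]cE [ltRHS]mulrC ltr_pM2r // /c; lra.
- by rewrite (lt_le_trans yy') // -[leRHS]cE ler_peMr ?(ltW d0) // /c; lra.
- rewrite opprB addrC addrA subrK -scalerBr rnormZ normcC rnormB -couplingB.
  rewrite (le_lt_trans (ler_wpM2l (normr_ge0 _) K_small)) //.
  rewrite (mulrA `|nu| C).
  by rewrite -[ltRHS]cE [ltRHS]mulrC ltr_pM2r // /c; lra.
- rewrite -[X in rnorm X]/(- B' x + D y - (- B' x' + D y')).
  have -> : - B' x + D y - (- B' x' + D y') = B' (K (y - y')) + (D y - D y').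
    have -> : K (y - y') = x' - x by rewrite -[LHS]opprK -xx' opprB.
    rewrite (op_linB lB' (aB ax') (dom_adj Au)).
    by rewrite opprD opprK addrACA [- _ + _]addrC.
  rewrite (le_lt_trans (rnormD _ _)) //.
  (* [B'] is in general unbounded, but it acts here on the range of [K], where [coupling_adj_bound]
     applies. *)
  have BK_small : rnorm (B' (K (y - y'))) <= C * (e / c).
    by rewrite (le_trans (coupling_adj_bound cK _)) // ler_wpM2l // ltW.
  rewrite (lt_le_trans (ler_ltD BK_small DD')) // -[leRHS]cE.
  by rewrite -{2}[e / c]mul1r -mulrDl [leRHS]mulrC ler_pM2r // /c; lra.
Qed.

(** Now [K y] is in [dom A] for every [y] in [dom D], so [x + K y] lies in [dom A] exactly when [x]
    does. *)
Lemma block_op_eq_schur_op : dom D `<=` dom B ->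
  dom M0 = dom A `*` dom D /\ graph M0 = graph schur_op.
Proof.
move=> DB.
have domM0 : dom M0 = dom A `*` dom D.
  apply/seteqP; split=> -[x y] /=; first by case=> -[? _] [].
  by case=> /= Ax Dy; do !split=> //; [exact/aB/(assoc_dom assA)|exact: DB].
split=> //; apply/seteqP; split; first exact: block_op_sub_schur_op.
move=> [[x y] _] [[/= Dy Au] ->].
have [AK AKE] := coupling_on_dom (DB _ Dy).
have M0xy : dom M0 (x, y).
  by rewrite domM0; split=> //=; rewrite -(addrK (K y) x); exact: (dom_linB lA).
split=> //=.
by have [_ /= ->] := block_op_sub_schur_op (conj M0xy erefl :
  graph M0 ((x, y), M0 (x, y))).
Qed.

End SchurComplement.

(** * Changing the point of the resolvent set *)

Section BoundedClosure.
Variables (R : realType) (U V : normedModType R[i]) (f : U -> V) (C : R).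
Hypothesis fB : forall x y, f (x - y) = f x - f y.
Hypotheses (C0 : 0 <= C) (f_bounded : forall x, rnorm (f x) <= C * rnorm x).

Lemma closure_graph_bounded (T : partop U V) : dense (dom T) ->
  (forall x, dom T x -> T x = f x) ->
  closure (graph T) = graph (Partop setT f).
Proof.
move=> /denseP dT Tf; apply/seteqP; split=> -[x y].
  move=> /closure_graphP cl; split=> //=.
  apply/eqP; rewrite -subr_eq0; apply/eqP/rnorm_eq0/eqP.
  rewrite eq_le rnorm_ge0 andbT; apply: (@le0_eps _ _ (C + 1)).
    by rewrite addr_ge0.
  move=> e e0; have [x' Tx' [xx' yy']] := cl e e0.
  have -> : y - f x = y - T x' - f (x - x')
    by rewrite fB Tf // opprB addrA subrK.
  rewrite (le_trans (rnormD _ _)) //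
    rnormN mulrDl mul1r addrC lerD ?(ltW yy') //.
  by rewrite (le_trans (f_bounded _)) // ler_wpM2l // ltW.
move=> [_ /= ->]; apply/closure_graphP => e e0.
have C1 : 0 < C + 1 by rewrite ltr_wpDl.
have d0 : 0 < e / (C + 1) by rewrite divr_gt0.
have [x' Tx' xx'] := dT x _ d0; exists x' => //; split.
  by rewrite (lt_le_trans xx') // ler_pdivrMr // ler_peMr ?(ltW e0) // lerDr.
rewrite Tf // -fB (le_lt_trans (f_bounded _)) //.
move: xx'; rewrite ltr_pdivlMr // mulrC; apply: le_lt_trans.
by rewrite ler_wpM2r ?rnorm_ge0 // lerDl.
Qed.

End BoundedClosure.

Section Resolvent.
Variables (R : realType) (U : normedModType R[i]) (T : partop U U) (nu : R).
Hypotheses (lT : linear_op T) (nuT : resolvent_set T nu%:C).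
Local Notation S := (inv_op (shift_op T nu%:C)).

Lemma resolventP w : dom T (S w) /\ T (S w) - nu%:C *: S w = w.
Proof.
have [_ sT _] := nuT; have : dom S w by rewrite sT.
move=> [x Tx Txw].
have h : exists x, dom (shift_op T nu%:C) x /\ shift_op T nu%:C x = w
  by exists x.
exact: (@getPex _
  [set x | dom (shift_op T nu%:C) x /\ shift_op T nu%:C x = w] h).
Qed.

Lemma resolvent_unique x w : dom T x -> T x - nu%:C *: x = w -> S w = x.
Proof.
move=> Tx Txw; have [inj _ _] := nuT; have [TS TSw] := resolventP w.
by apply: inj; rewrite ?inE //= TSw.
Qed.

Lemma resolventB v w : S (v - w) = S v - S w.
Proof.
have [Tv Sv] := resolventP v; have [Tw Sw] := resolventP w.
apply: resolvent_unique; first exact: (dom_linB lT).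
by rewrite (op_linB lT) // scalerBr opprD addrACA -opprD Sv Sw.
Qed.

Lemma resolvent_bounded : exists2 C : R, 0 <= C &
  forall w, rnorm (S w) <= C * rnorm w.
Proof.
have [_ sT [C hC]] := nuT; exists `|C| => // w.
have := hC w; rewrite sT => /(_ I); rewrite !rnormE -rmorphM lecR => h.
by rewrite (le_trans h) // ler_wpM2r ?rnorm_ge0 // ler_norm.
Qed.

End Resolvent.

Lemma below_min_resolvent (R : realType) (U : normedModType R[i])
    (T : partop U U) (nu : R) :
  below_min nu%:C (spectrum T) -> resolvent_set T nu%:C.
Proof.
move=> [m [_ lbm num]]; apply: contrapT => /lbm mnu.
by have := lt_le_trans num mnu; rewrite ltxx.
Qed.

Section CouplingShift.
Variables (R : realType) (H1 H2 : completeNormedModType R[i]).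
Variables (ip1 : {dot H1 for Num.conj}) (ip2 : {dot H2 for Num.conj}).
Variables (A : partop H1 H1) (B : partop H2 H1) (a : qform H1).
Variables (nu C mu : R) (K : H2 -> H1).
Hypotheses (n1 : inner_product_norm ip1) (saA : selfadjoint ip1 A).
Hypotheses (dB : dense (dom B)) (assA : associated_form ip1 A a).
Hypothesis aB : fdom a `<=` dom (adjoint ip2 ip1 B).
Hypothesis cK : coupling ip1 ip2 a B nu C K.
Hypothesis muA : resolvent_set A mu%:C.
Local Notation S := (inv_op (shift_op A mu%:C)).
Local Notation G := (comp_op S B).

Let lA : linear_op A := sa_linear (hilbert_ip_continuous n1) saA.

(* By the resolvent identity, the coupling operator at the point [mu]. *)
Definition coupling_shift (y : H2) : H1 := K y + (mu - nu)%:C *: S (K y).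

Lemma coupling_shift_bounded : exists2 C' : R, 0 <= C' &
  forall y, rnorm (coupling_shift y) <= C' * rnorm y.
Proof.
have [c c0 hc] := resolvent_bounded muA; have C0 := coupling_ge0 cK.
exists (C + `|mu - nu| * (c * C)); first by rewrite addr_ge0 ?mulr_ge0.
move=> y; rewrite (le_trans (rnormD _ _)) // rnormZ normcC mulrDl.
rewrite lerD ?(coupling_bound cK) // -!mulrA ler_wpM2l //.
by rewrite (le_trans (hc _)) // ler_wpM2l // (coupling_bound cK).
Qed.

Lemma coupling_shiftB y z :
  coupling_shift (y - z) = coupling_shift y - coupling_shift z.
Proof.
rewrite /coupling_shift (couplingB cK) (resolventB lA muA) scalerBr opprD.
by rewrite addrACA.
Qed.

Lemma coupling_shift_dom x y :
  dom A (x + coupling_shift y) <-> dom A (x + K y).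
Proof.
have [AS _] := resolventP muA (K y); have AS' := dom_linZ lA (mu - nu)%:C AS.
rewrite /coupling_shift addrA; split=> [h|h]; last exact: (dom_linD lA).
by rewrite -(addrK ((mu - nu)%:C *: S (K y)) (x + K y)); exact: (dom_linB lA).
Qed.

(** [A - mu] maps the correction [(mu - nu) S (K y)] to [(mu - nu) K y], which turns [- mu K y] into
    [- nu K y]. *)
Lemma coupling_shift_val x y : dom A (x + K y) ->
  A (x + coupling_shift y) - mu%:C *: (x + coupling_shift y) + mu%:C *: x =
  A (x + K y) - nu%:C *: K y.
Proof.
move=> Ax; have [AS SE] := resolventP muA (K y).
have AS' := dom_linZ lA (mu - nu)%:C AS.
rewrite /coupling_shift addrA (op_linD lA) // (op_linZ lA) //.
have -> : A (S (K y)) = K y + mu%:C *: S (K y).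
  by apply/eqP; rewrite -subr_eq; exact/eqP.
set k := K y; set s := S k; set m := mu%:C *: k; set n := nu%:C *: k.
set b := (mu - nu)%:C *: (mu%:C *: s); set X := mu%:C *: x.
have -> : (mu - nu)%:C *: (k + mu%:C *: s) = m - n + b.
  by rewrite scalerDr /m /n -scalerBl -rmorphB.
have -> : mu%:C *: (x + k + (mu - nu)%:C *: s) = X + m + b.
  by rewrite !scalerDr /b !scalerA mulrC.
rewrite addrAC -[_ + _ + X]addrA.
have -> : m - n + b + X = X + m + b - n.
  by rewrite [RHS]addrAC -[X + m - n]addrA -[RHS]addrA addrC.
by rewrite addrA addrAC addrK.
Qed.

Lemma dom_resolvent_comp : dom G = dom B.
Proof.
have [_ sT _] := muA.
apply/seteqP; split=> [y []//|y By].
have Sy : dom S (B y) by rewrite sT.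
by split.
Qed.

(** At [x = 0] the shift formula says that [A - mu] maps [coupling_shift y] to [A (K y) - nu K y],
    which is [B y]. *)
Lemma resolvent_comp_eq y : dom G y -> G y = coupling_shift y.
Proof.
rewrite dom_resolvent_comp => By;
  have [AK AKE] := coupling_on_dom assA aB cK By.
have AK0 : dom A (0 + K y) by rewrite add0r.
apply: (resolvent_unique muA).
  by rewrite -[coupling_shift y]add0r coupling_shift_dom.
have := coupling_shift_val AK0; rewrite !add0r scaler0 addr0 => ->.
by rewrite AKE addrK.
Qed.

Lemma closure_resolvent_comp :
  [/\ bounded_op G, dense (dom G), dom (closure_op G) = setT &
      forall y, closure_op G y = coupling_shift y].
Proof.
have [C' C'0 hC'] := coupling_shift_bounded.
have dG : dense (dom G) by rewrite dom_resolvent_comp.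
have [_ domG opG] := closure_op_eq
  (closure_graph_bounded coupling_shiftB C'0 hC' dG resolvent_comp_eq).
split=> // [|y]; last exact: opG.
exists C' => y Gy; rewrite resolvent_comp_eq // !rnormE -rmorphM lecR.
exact: hC'.
Qed.

End CouplingShift.

Lemma selfadjoint_op_eq (R : realType) (H : normedModType R[i])
    (ip : {dot H for Num.conj}) (S T : partop H H) :
  ip_continuous ip -> op_eq S T -> selfadjoint ip T -> selfadjoint ip S.
Proof.
move=> cip /op_eqP[dST ST] saT; apply: (selfadjointI cip); rewrite dST.
- by case: saT.
- by move=> x y Tx Ty; rewrite !ST //; exact: sa_sym.
move=> y z h; have [|Ty <-] := sa_max cip saT (y := y) (z := z).
  by move=> x Tx; rewrite -ST // h.
by rewrite ST.
Qed.

Lemma closure_graph_comp_J (R : realType) (H1 H2 : normedModType R[i])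
    (S T : partop (H1 * H2)%type (H1 * H2)%type) :
  closure (graph S) = graph T ->
  closure (graph (comp_op (@J_op R H1 H2) S)) =
    graph (comp_op (@J_op R H1 H2) T).
Proof.
move=> ST; apply/seteqP; split=> -[p q].
  move=> /closure_graph_J; rewrite ST => -[Tp qE]; split; first by split.
  by rewrite -[RHS]/((T p).1, - (T p).2) -qE /= opprK -surjective_pairing.
move=> [[Tp _] qE]; apply/closure_graph_J; rewrite ST; split=> //.
by rewrite [q]qE -[LHS]/((T p).1, - - (T p).2) opprK -surjective_pairing.
Qed.

(** * The block operator, studied through the graph of its closure *)

Section BlockOperator.
Variables (R : realType) (H1 H2 : completeNormedModType R[i]).
Variables (ip1 : {dot H1 for Num.conj}) (ip2 : {dot H2 for Num.conj}).
Variables (A : partop H1 H1) (B : partop H2 H1) (D : partop H2 H2).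
Variables (a : qform H1) (nu C : R) (K : H2 -> H1).
Hypotheses (n1 : inner_product_norm ip1) (n2 : inner_product_norm ip2).
Hypotheses (saA : selfadjoint ip1 A) (saD : selfadjoint ip2 D).
Hypotheses (dB : dense (dom B)) (assA : associated_form ip1 A a).
Local Notation B' := (adjoint ip2 ip1 B).
Hypothesis aB : fdom a `<=` dom B'.
Hypothesis cK : coupling ip1 ip2 a B nu C K.
Local Notation ip := (dsum_ip ip1 ip2).
Local Notation M0 := (block_op A B (opp_op B') D).
Local Notation JM0 := (comp_op (@J_op R H1 H2) M0).
Local Notation M := (closure_op M0).
Local Notation Mt := (schur_op ip1 ip2 A B D nu K).

Let c1 := hilbert_ip_continuous n1.
Let c2 := hilbert_ip_continuous n2.
Let cip := dsum_ip_continuous c1 c2.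

Lemma block_op_ess_selfadjoint : closure (graph M0) = graph Mt ->
  @ess_selfadjoint R (H1 * H2)%type ip JM0.
Proof.
move=> clM0; have [closableJ domJ opJ] :=
  closure_op_eq (closure_graph_comp_J clM0).
split=> //; apply: (selfadjoint_op_eq cip) (schur_op_selfadjoint n1 n2 saA saD
  dB assA aB cK).
exact/op_eqP.
Qed.

Lemma block_op_selfadjoint : graph M0 = graph Mt ->
  @selfadjoint R (H1 * H2)%type ip JM0.
Proof.
move=> gM0; apply: (selfadjoint_op_eq cip) (schur_op_selfadjoint n1 n2 saA saD
  dB assA aB cK).
have [dM0 opM0] : dom M0 = dom Mt /\ forall p, dom Mt p -> M0 p = Mt p
  by exact/op_eqP.
apply/op_eqP; split=> [|p [Mp _]].
  by apply/seteqP; split=> p [Mp _]; split=> //; move: Mp; rewrite dM0.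
rewrite -[LHS]/((M0 p).1, - (M0 p).2) opM0 //.
Qed.

Hypothesis clM0 : closure (graph M0) = graph Mt.

Let domM : dom M = dom Mt. Proof. by have [] := closure_op_eq clM0. Qed.
Let opM p : dom M p -> M p = Mt p.
Proof. by rewrite domM; have [_ _] := closure_op_eq clM0; apply. Qed.

Lemma dom_closure_block_op x y : dom M (x, y) -> fdom a x.
Proof.
rewrite domM => -[_ Au]; rewrite -(addrK (K y) x).
apply: (fdomB (assoc_hermitian assA)); first exact: (assoc_dom assA).
exact: (coupling_dom cK).
Qed.

(** Splitting [a (x + K y) x'] by linearity, the part with [K y] minus [nu <K y, x'>] is
    [<y, B' x'>] by the defining relation of [K]. *)
Lemma closure_block_op_form x y x' y' : dom M (x, y) -> fdom a x' ->
  ip (M (x, y)) (x', y') =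
  a x x' + ip2 y (B' x') - ip2 (B' x) y' + ip2 (D y) y'.
Proof.
move=> Mxy ax'; have ax := dom_closure_block_op Mxy; rewrite opM //.
move: Mxy; rewrite domM => -[/= Dy Au].
have -> : ip (Mt (x, y)) (x', y') =
  ip1 (A (x + K y) - nu%:C *: K y) x' + ip2 (- B' x + D y) y' by [].
rewrite ipBl ipZl -(assocE assA) // ipDl ipNl.
rewrite (qformDl (assoc_hermitian assA)) //; last exact: (coupling_dom cK).
by rewrite -(coupling_form cK) //; ring.
Qed.

Section AtPoint.
Variable mu : R.
Hypothesis muA : below_min mu%:C (spectrum A).
Local Notation G := (comp_op (inv_op (shift_op A mu%:C)) B).

Let resA := below_min_resolvent muA.

Lemma closure_block_op_at :
  [/\ [/\ bounded_op G, dense (dom G) & dom (closure_op G) = setT],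
      dom M = [set p | dom D p.2 /\ dom A (p.1 + closure_op G p.2)] &
      forall x y, dom M (x, y) ->
        M (x, y) = (shift_op A mu%:C (x + closure_op G y) + mu%:C *: x,
                    - B' x + D y)].
Proof.
have [bG dG domG opG] := closure_resolvent_comp n1 saA dB assA aB cK resA.
split=> [//||x y Mxy].
  rewrite domM; apply/seteqP; split=> -[x y] [Dy Au]; split=> //; move: Au;
    rewrite opG; have [h1 h2] := coupling_shift_dom nu K n1 saA resA x y.
    exact: h2.
  exact: h1.
rewrite opM // opG; move: Mxy; rewrite domM => -[_ Au].
congr (_, _).
by rewrite -(coupling_shift_val nu n1 saA resA).
Qed.

End AtPoint.
End BlockOperator.

Theorem theorem2p4 (R : realType) (H1 H2 : completeNormedModType R[i])
    (ip1 : {dot H1 for Num.conj}) (ip2 : {dot H2 for Num.conj})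
    (A : partop H1 H1) (B : partop H2 H1) (D : partop H2 H2)
    (a : qform H1) (d : qform H2) :
  inner_product_norm ip1 -> inner_product_norm ip2 ->
  (exists x : H1, x <> 0) -> (exists y : H2, y <> 0) ->
  selfadjoint ip1 A -> bounded_from_below ip1 A ->
  linear_op B -> dense (dom B) -> closable_op B ->
  selfadjoint ip2 D -> bounded_from_above ip2 D ->
  associated_form ip1 A a -> associated_form ip2 D d ->
  let Badj := adjoint ip2 ip1 B in
  let ip := dsum_ip ip1 ip2 in
  let M0 := block_op A B (opp_op Badj) D in
  let JM0 := comp_op (@J_op R H1 H2) M0 in
  let M := closure_op M0 in
  let cond_I := [/\ fdom a `<=` dom Badj, dom B `<=` dom D & core D (dom B)] in
  let cond_II := fdom a `<=` dom Badj /\ fdom d `<=` dom B in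
  [/\ cond_I -> ess_selfadjoint ip JM0 /\ closable_op M0,
      cond_II -> [/\ selfadjoint ip JM0, closed_op M0,
                     dom M0 = dom A `*` dom D & op_eq M0 M] &
      cond_I \/ cond_II ->
      [/\ forall nu : R, below_min nu%:C (spectrum A) ->
            let G := comp_op (inv_op (shift_op A nu%:C)) B in
            let K := closure_op G in
            [/\ [/\ bounded_op G, dense (dom G) & dom K = setT],
                dom M = [set p | dom D p.2 /\ dom A (p.1 + K p.2)] &
                forall x y, dom M (x, y) ->
                  M (x, y) = (shift_op A nu%:C (x + K y) + nu%:C *: x,
                              - Badj x + D y)],
          forall x y, dom M (x, y) -> fdom a x &
          forall x y x' y', dom M (x, y) -> fdom a x' ->
            ip (M (x, y)) (x', y') =
              a x x' + ip2 y (Badj x') - ip2 (Badj x) y' + ip2 (D y) y']].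
Proof.
move=> n1 n2 _ _ saA lowA _ dB _ saD _ assA assD Badj ip M0 JM0 M cond_I
  cond_II.
have [c ac] := assoc_bounded_below n1 saA lowA assA.
have coupled : fdom a `<=` dom Badj ->
  exists C K, coupling ip1 ip2 a B (c - 1) C K.
  by move=> aB; exact: (coupling_exists n1 n2 dB assA ac aB).
(* Condition (II) speaks of form domains, and [dom D] lies in the domain of [d]. *)
have domDB : cond_II -> dom D `<=` dom B.
  by move=> [_ dB'] y Dy; exact/dB'/(assoc_dom assD).
split.
- move=> [aB BD coreB]; have [C [K cK]] := coupled aB.
  have clM0 := closure_block_op_core n1 n2 saA saD dB assA aB cK BD coreB.
  split; last by have [] := closure_op_eq clM0.
  exact: (block_op_ess_selfadjoint n1 n2 saA saD dB assA aB cK clM0).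
- move=> II; have [aB _] := II; have [C [K cK]] := coupled aB.
  have [domM0 gM0] := block_op_eq_schur_op n1 saA assA aB cK (domDB II).
  have clM0 : closure (graph M0) = graph M0.
    by rewrite gM0; exact: (closure_schur_op n1 n2 saA saD dB assA aB cK).
  split=> //; first exact: (block_op_selfadjoint n1 n2 saA saD dB assA aB cK
    gM0).
    by apply/closure_id; rewrite clM0.
  have [_ dM opM] := closure_op_eq clM0.
  apply/op_eqP; split; first by rewrite dM.
  by move=> p; rewrite dM => /opM.
move=> I_or_II.
have aB : fdom a `<=` dom Badj by case: I_or_II => -[].
have [C [K cK]] := coupled aB.
have clM0 : closure (graph M0) = graph (schur_op ip1 ip2 A B D (c - 1) K).
  case: I_or_II => [[_ BD coreB]|II];
    first exact: (closure_block_op_core n1 n2 saA saD dB assA aB cK BD coreB).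
  have [_ ->] := block_op_eq_schur_op n1 saA assA aB cK (domDB II).
  exact: (closure_schur_op n1 n2 saA saD dB assA aB cK).
split=> [nu nuA|x y|x y x' y'].
- exact: (closure_block_op_at n1 saA dB assA aB cK clM0 nuA).
- exact: (dom_closure_block_op assA cK clM0).
- exact: (closure_block_op_form assA cK clM0).
Qed.
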